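(* Let $N\ge1$ be an integer and $\alpha>0$. Let $0<\gamma<N$, $\gamma<\frac2\alpha$, and let $\omega\in L^\infty(\mathbb R^N)$ be homogeneous of degree $0$, $\omega\ge0$, $\omega\not\equiv0$. Suppose that $\varphi\in L^1_{\rm loc}(\mathbb R^N)$, $\varphi\ge0$, is such that $\varphi(x)\ge\omega(x)|x|^{-\gamma}$ for $|x|\le\epsilon$, for some $\epsilon>0$. Then, for the equation $\partial_tu=\Delta u+|u|^\alpha u$ on $\mathbb R^N$ with $u(0)=\lambda\varphi$, one has $T_{\max}(\lambda\varphi)<\infty$ for $\lambda>0$ sufficiently large and $$\limsup_{\lambda\to\infty}\lambda^{\left(\frac1\alpha-\frac\gamma2\right)^{-1}}T_{\max}(\lambda\varphi)\ \le\ \frac{1}{\left(\alpha^{1/\alpha}\left\|e^{\Delta}(\omega|\cdot|^{-\gamma})\right\|_\infty\right)^{\left(\frac1\alpha-\frac\gamma2\right)^{-1}}} .$$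
   Context: $e^{t\Delta}$ is the heat semigroup on $\mathbb R^N$ (convolution with $G_t(x)=(4\pi t)^{-N/2}e^{-|x|^2/4t}$), and $e^\Delta$ is its value at $t=1$. For $u_0\ge0$ locally integrable, $T_{\max}(u_0)\in[0,\infty]$ is the maximal existence time of a nonnegative solution of $u(t)=e^{t\Delta}u_0+\int_0^te^{(t-\sigma)\Delta}[|u(\sigma)|^\alpha u(\sigma)]\,d\sigma$, i.e. the supremum of the $T>0$ for which there is a nonnegative, a.e. finite measurable function $u$ on $(0,T)\times\mathbb R^N$ satisfying this equation ($T_{\max}(u_0)=0$ if there is no such $T$). *)

(* Defs.v *)
From HB Require Import structures.
From mathcomp Require Import all_boot all_order all_algebra.
From mathcomp Require Import all_classical all_reals all_analysis.
From mathcomp Require Import measurable_realfun.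

Set Implicit Arguments.
Unset Strict Implicit.
Unset Printing Implicit Defensive.
Import Order.TTheory GRing.Theory Num.Theory.
Import numFieldNormedType.Exports.

Local Open Scope classical_set_scope.
Local Open Scope ring_scope.

(* R^n, with the product of the Borel sigma-algebras (the Borel sigma-algebra
   of R^n). *)
Notation euclid R n := (n.-tuple (measurableTypeR R)).

Section vectors.
Context {R : realType} {n : nat}.
Implicit Types x y : euclid R n.

Definition vsub x y : euclid R n := [tuple tnth x i - tnth y i | i < n].
Definition vscale (m : R) x : euclid R n := [tuple m * tnth x i | i < n].
Definition enorm x : R := Num.sqrt (\sum_(i < n) tnth x i ^+ 2).

End vectors.

Section lebesgue_measure_on_Rn.
Context {R : realType}.

Definition consv n (p : measurableTypeR R * euclid R n) : euclid R n.+1 :=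
  [the n.+1.-tuple (measurableTypeR R) of p.1 :: p.2].

Lemma measurable_consv n : measurable_fun [set: _] (@consv n).
Proof. exact: measurable_cons. Qed.

Definition unconsv n (x : euclid R n.+1) : measurableTypeR R * euclid R n :=
  (thead x, [tuple of behead x]).

Lemma measurable_unconsv n : measurable_fun [set: _] (@unconsv n).
Proof.
apply/measurable_fun_pairP; split; last exact: measurable_behead.
exact: measurable_tnth.
Qed.

Lemma consvK n : cancel (@consv n) (@unconsv n).
Proof.
by move=> [a x]; congr pair; apply: val_inj.
Qed.

Lemma unconsvK n : cancel (@unconsv n) (@consv n).
Proof. by move=> x; apply: val_inj; rewrite /= [in RHS](tuple_eta x). Qed.

Section step.
Variables (n : nat) (mu : {sigma_finite_measure set (euclid R n) -> \bar R}).

Definition lebesgue_step : set (euclid R n.+1) -> \bar R :=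
  pushforward (lebesgue_measure \x mu)%E (@consv n).

Let lebesgue_step0 : lebesgue_step set0 = 0%E.
Proof. by rewrite /lebesgue_step /pushforward preimage_set0 measure0. Qed.

Let lebesgue_step_ge0 A : (0 <= lebesgue_step A)%E.
Proof. by rewrite /lebesgue_step /pushforward measure_ge0. Qed.

Let lebesgue_step_sigma_additive : semi_sigma_additive lebesgue_step.
Proof.
have mpre A : measurable A -> measurable (@consv n @^-1` A).
  by move=> mA; rewrite -[X in measurable X]setTI; exact: measurable_consv.
move=> F mF tF mUF; rewrite /lebesgue_step /pushforward preimage_bigcup.
apply: measure_semi_sigma_additive.
- by move=> k; exact: mpre.
- apply/trivIsetP => /= i j _ _ ij; rewrite -preimage_setI.
  by move/trivIsetP : tF => /(_ _ _ _ _ ij) ->//; rewrite preimage_set0.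
- by rewrite -preimage_bigcup; exact: mpre.
Qed.

HB.instance Definition _ := isMeasure.Build _ _ _ lebesgue_step
  lebesgue_step0 lebesgue_step_ge0 lebesgue_step_sigma_additive.

Let lebesgue_step_sigma_finite : sigma_finite setT lebesgue_step.
Proof.
have /sigma_finiteP[F [TF ndF Foo]] := sigma_finiteT (@lebesgue_measure R).
have /sigma_finiteP[G [TG ndG Goo]] := sigma_finiteT mu.
exists (fun k => @unconsv n @^-1` (F k `*` G k)).
  apply/esym; rewrite -subTset => x _.
  have [i _ Fi] : (\bigcup_k F k) (unconsv x).1 by rewrite -TF.
  have [j _ Gj] : (\bigcup_k G k) (unconsv x).2 by rewrite -TG.
  exists (maxn i j) => //; split.
  - by apply: (subsetPset _ _ (ndF _ _ (leq_maxl i j))).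
  - by apply: (subsetPset _ _ (ndG _ _ (leq_maxr i j))).
move=> k; have [mFk Fk] := Foo k; have [mGk Gk] := Goo k; split.
  rewrite -[X in measurable X]setTI; apply: measurable_unconsv => //.
  exact: measurableX.
rewrite /lebesgue_step /pushforward -comp_preimage.
rewrite (_ : _ \o _ = id); last by apply/funext => p; exact: consvK.
by rewrite product_measure1E// lte_mul_pinfty// ge0_fin_numE.
Qed.

HB.instance Definition _ := Measure_isSigmaFinite.Build _ _ _ lebesgue_step
  lebesgue_step_sigma_finite.

End step.

(* Lebesgue measure on R^n: the image of lebesgue_measure (x) lebesgue_n under
   (a, x) |-> a :: x; see lebesgue_n_box. *)
Fixpoint lebesgue_n n : {sigma_finite_measure set (euclid R n) -> \bar R} :=
  match n with
  | 0 => [the sigma_finite_measure _ _ of \d_([tuple] : euclid R 0)]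
  | m.+1 => [the sigma_finite_measure _ _ of lebesgue_step (lebesgue_n m)]
  end.

Lemma lebesgue_n_box n (A : 'I_n -> set (measurableTypeR R)) :
  (forall i, measurable (A i)) ->
  lebesgue_n n [set x | forall i, A i (tnth x i)] =
  (\prod_(i < n) lebesgue_measure (A i))%E.
Proof.
elim: n A => [|n IH] A mA.
  by rewrite big_ord0 /= diracE mem_set// => -[].
rewrite big_ord_recl -IH//= /lebesgue_step /pushforward.
rewrite -product_measure1E//; last first.
  rewrite (_ : [set x | _] = \bigcap_(i : 'I_n)
     ((fun x : euclid R n => tnth x i) @^-1` A (lift ord0 i))).
    apply: fin_bigcap_measurable; first exact: finite_finset.
    by move=> i _; rewrite -[X in measurable X]setTI; exact: measurable_tnth.
  by apply/seteqP; split=> [x Ax i _|x Ax i]; [exact: Ax|exact: Ax].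
congr product_measure1; apply/seteqP; split=> -[a x] /=.
- move=> Aax; split; first exact: (Aax ord0).
  by move=> i; have := Aax (lift ord0 i); rewrite tnthS.
- move=> [Aa Ax] i; case: (unliftP ord0 i) => [j|] -> //.
  by rewrite tnthS; exact: Ax.
Qed.

End lebesgue_measure_on_Rn.

Section heat.
Context {R : realType} {n : nat}.
Local Notation mu := (@lebesgue_n R n).

Definition gauss (t : R) (x : euclid R n) : R :=
  (4 * pi * t) `^ (- (n%:R / 2)) * expR (- (enorm x ^+ 2 / (4 * t))).

(* (e^{t Delta} f)(x); every f below is nonnegative, so that the integral
   always makes sense in [0, +oo]. *)
Definition heat (t : R) (f : euclid R n -> \bar R) (x : euclid R n) : \bar R :=
  (\int[mu]_y ((gauss t (vsub x y))%:E * f y))%E.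

Definition L1loc (f : euclid R n -> R) : Prop :=
  forall r : R, mu.-integrable [set x | enorm x <= r] (EFin \o f).

(* Equality holds almost everywhere because this is applied to elements of
   L^oo, which are only defined up to a null set. *)
Definition homogeneous (d : R) (f : euclid R n -> R) : Prop :=
  forall m : R, 0 < m -> {ae mu, forall x, f (vscale m x) = m `^ d * f x}.

End heat.

Section life_span.
Context {R : realType} {n : nat}.
Local Notation mu := (@lebesgue_n R n).
Local Open Scope ereal_scope.

Definition nonlinearity (alpha : R) (v : \bar R) : \bar R := `|v| `^ alpha * v.

(* The values of u lie in [0, +oo], so both sides of the integral equation
   always make sense. *)
Definition mild_solution (alpha : R) (u0 : euclid R n -> R) (T : R)
    (u : measurableTypeR R * euclid R n -> \bar R) : Prop :=
  let Q : set (measurableTypeR R * euclid R n) :=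
    `]0%R, T[%classic `*` [set: euclid R n] in
  [/\ measurable_fun Q u,
      forall p, Q p -> 0 <= u p,
      {ae lebesgue_measure \x mu, forall p, Q p -> u p \is a fin_num} &
      {ae lebesgue_measure \x mu, forall p, Q p ->
        u p = heat p.1 (EFin \o u0) p.2 +
          \int[lebesgue_measure]_(s in `]0%R, p.1[)
            heat (p.1 - s) (fun y => nonlinearity alpha (u (s, y))) p.2}].

(* The point 0 gives the value of the supremum when no solution exists. *)
Definition Tmax (alpha : R) (u0 : euclid R n -> R) : \bar R :=
  ereal_sup ([set 0] `|` [set T%:E | T in
    [set T : R | (0 < T)%R /\ exists u, mild_solution alpha u0 T u]]).

End life_span.

(* Main.v *)
(* Weissler's bound: if u is a nonnegative mild solution on (0, T), then
   alpha t (e^{t Delta} u0)(x)^alpha <= 1 for almost every (t, x).  Indeed, fix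
   such a (t, x) and put
     H(s) = (e^{t Delta} u0)(x) + int_0^s (e^{(t-r) Delta} u(r)^{1+alpha})(x) dr.
   By the semigroup property H(s) = (e^{(t-s) Delta} u(s))(x) for almost every
   s, so Jensen's inequality gives H' >= H^{1+alpha}; since H(t) = u(t, x) is
   finite, H(0)^{-alpha} >= alpha t.
   Applied to u0 = lambda phi >= lambda omega |.|^{-gamma} 1_{|.| <= epsilon},
   at the points sqrt t x, homogeneity turns this bound into
     lambda alpha^{1/alpha} t^{1/alpha - gamma/2} M <= 1
   for t <= (epsilon / k)^2 as soon as M is exceeded, on a set of positive
   measure, by e^Delta of omega |.|^{-gamma} truncated to the ball of radius k.
   Every M below the sup norm of e^Delta(omega |.|^{-gamma}) is exceeded for k
   large. *)
Require Import Defs.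
From HB Require Import structures.
From mathcomp Require Import all_boot all_order all_algebra.
From mathcomp Require Import all_classical all_reals all_analysis.
From mathcomp Require Import measurable_realfun.
From mathcomp Require Import ess_sup_inf ring lra.
Set Implicit Arguments.
Unset Strict Implicit.
Unset Printing Implicit Defensive.
Import Order.TTheory GRing.Theory Num.Theory.
Import numFieldNormedType.Exports.
Local Open Scope classical_set_scope.
Local Open Scope ring_scope.

(** * Lebesgue measure on R^n *)

Section lebesgue_n.
Context {R : realType}.
Implicit Type n : nat.

Lemma measurable_enorm n : measurable_fun setT (@enorm R n).
Proof.
rewrite /enorm; apply: measurableT_comp => //.
  by apply: continuous_measurable_fun; exact: sqrt_continuous.
apply: measurable_sum => i; apply: measurable_funX; exact: measurable_tnth.
Qed.

Lemma measurable_vscaler n (m : R) : measurable_fun setT (@vscale R n m).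
Proof.
apply/measurable_fun_tnthP => i.
rewrite (_ : _ \o _ = fun x : euclid R n => m * tnth x i).
  by apply: measurable_funM => //; exact: measurable_tnth.
by apply/funext => x /=; rewrite tnth_mktuple.
Qed.

Lemma measurable_vsub n : measurable_fun setT
  (fun p : euclid R n * euclid R n => vsub p.1 p.2).
Proof.
apply/measurable_fun_tnthP => i.
rewrite (_ : _ \o _ = fun p : euclid R n * euclid R n => tnth p.1 i - tnth p.2 i).
  by apply: measurable_funB;
    apply: (@measurableT_comp _ _ _ _ _ _ (fun x : euclid R n => tnth x i)) => //;
    exact: measurable_tnth.
by apply/funext => p /=; rewrite tnth_mktuple.
Qed.

(** By uniqueness of Lebesgue measure it suffices to compare half-open intervals; the preimage of
    []a, b]] has length (b - a) / m. *)
Lemma lebesgue_measure_scale (m : R) (A : set (measurableTypeR R)) :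
  0 < m -> measurable A ->
  (m%:E * pushforward (@lebesgue_measure R)
    ( *%R m : _ -> measurableTypeR R) A)%E = lebesgue_measure A.
Proof.
move=> m0 mA; apply/esym.
have mm : measurable_fun [set: measurableTypeR R]
    ( *%R m : _ -> measurableTypeR R) by exact: measurable_funM.
apply: (@lebesgue_measure_unique R (mscale (NngNum (ltW m0))
  (pushforward (@lebesgue_measure R) ( *%R m : _ -> measurableTypeR R)))) => //.
move=> _ [[a b]] _ <-; rewrite /pushforward
  -[RHS]/(m%:E * lebesgue_measure ( *%R m @^-1` `]a, b]))%E.
rewrite (_ : _ @^-1` _ = `]m^-1 * a, m^-1 * b]%classic); last first.
  apply/seteqP; split => x /=; rewrite !in_itv/=.
    by rewrite ltr_pdivrMl// ler_pdivlMl.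
  by rewrite ltr_pdivrMl// ler_pdivlMl.
rewrite !lebesgue_measure_itv/= !lte_fin ltr_pM2l ?invr_gt0//.
case: ifP => _; last by rewrite mule0.
by rewrite -EFinD -EFinD -EFinM mulrDr mulrN !mulrA divff ?gt_eqF// !mul1r.
Qed.

Lemma ge0_integral_lebesgue_scale (m : R) (f : measurableTypeR R -> \bar R) :
  0 < m -> measurable_fun setT f -> (forall x, 0 <= f x)%E ->
  (\int[lebesgue_measure]_x f x =
   m%:E * \int[lebesgue_measure]_x f (m * x)%R)%E.
Proof.
move=> m0 mf f0.
have mm : measurable_fun [set: measurableTypeR R]
    ( *%R m : _ -> measurableTypeR R) by exact: measurable_funM.
rewrite (@eq_measure_integral _ _ _ _ (mscale (NngNum (ltW m0))
  (pushforward (@lebesgue_measure R) ( *%R m : _ -> measurableTypeR R)))) //.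
  by rewrite ge0_integral_mscale//= ge0_integral_pushforward.
by move=> A mA _; exact/esym/lebesgue_measure_scale.
Qed.

Lemma ge0_integral_lebesgue_n0 (f : euclid R 0 -> \bar R) :
  measurable_fun setT f ->
  (\int[lebesgue_n 0]_x f x = f [tuple])%E.
Proof.
by move=> mf; rewrite /= integral_dirac// diracT mul1e.
Qed.

Lemma ge0_integral_lebesgue_nS n (f : euclid R n.+1 -> \bar R) :
  measurable_fun setT f -> (forall x, 0 <= f x)%E ->
  (\int[lebesgue_n n.+1]_x f x =
   \int[lebesgue_measure]_a \int[lebesgue_n n]_x f (consv (a, x)))%E.
Proof.
move=> mf f0.
rewrite (@eq_measure_integral _ _ _ _
  (pushforward (lebesgue_measure \x lebesgue_n n)%E (@consv R n)))//.
  exact: measurable_consv.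
move=> mc; rewrite ge0_integral_pushforward//.
rewrite preimage_setT (fubini_tonelli1 (f \o @consv R n))//; last first.
  by move=> x; exact: f0.
exact: measurableT_comp.
Qed.

(** Induction on the dimension: Tonelli peels off the first coordinate. This reduces Gaussian
    integrals over R^n to one-dimensional ones. *)
Lemma ge0_integral_lebesgue_n_prod n (g : 'I_n -> R -> R) (c : 'I_n -> R) :
  (forall i, measurable_fun setT (g i)) -> (forall i x, 0 <= g i x) ->
  (forall i, \int[lebesgue_measure]_x (g i x)%:E = (c i)%:E)%E ->
  (\int[lebesgue_n n]_x (\prod_i g i (tnth x i))%:E = (\prod_i c i)%:E)%E.
Proof.
have mp k (h : 'I_k -> R -> R) : (forall i, measurable_fun setT (h i)) ->
   measurable_fun setT (fun x : euclid R k => (\prod_i h i (tnth x i))%:E).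
  move=> mh; apply/measurable_EFinP; apply: measurable_prod => i _.
  exact: (measurableT_comp (mh i) (measurable_tnth i)).
elim: n g c => [|n IH] g c mg g0 gc.
  by rewrite ge0_integral_lebesgue_n0 ?big_ord0//; exact: mp.
rewrite ge0_integral_lebesgue_nS; last 2 first.
  exact: mp.
  by move=> x; rewrite lee_fin prodr_ge0.
transitivity (\int[lebesgue_measure]_a
    ((g ord0 a)%:E * (\prod_i c (lift ord0 i))%:E))%E.
  apply: eq_integral => a _.
  rewrite -(IH (fun i => g (lift ord0 i)))// -ge0_integralZl//; last 3 first.
    exact: (mp _ (fun i => g (lift ord0 i))) (fun i => mg _).
    by move=> x _; rewrite lee_fin prodr_ge0.
    by rewrite lee_fin.
  apply: eq_integral => x _; rewrite big_ord_recl EFinM.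
  by congr (_ * _%:E)%E; apply: eq_bigr => i _; rewrite tnthS.
rewrite ge0_integralZr//; last 3 first.
  by apply/measurable_EFinP; exact: mg.
  by move=> x _; rewrite lee_fin.
  rewrite lee_fin prodr_ge0// => i _; rewrite -lee_fin -gc integral_ge0// => x _.
  by rewrite lee_fin.
by rewrite gc -EFinM big_ord_recl.
Qed.

(** Each coordinate contributes one factor [m], by induction on the dimension with the
    one-dimensional change of variables. *)
Lemma ge0_integral_lebesgue_n_scale n (m : R) (f : euclid R n -> \bar R) :
  0 < m -> measurable_fun setT f -> (forall x, 0 <= f x)%E ->
  (\int[lebesgue_n n]_x f x =
   (m ^+ n)%:E * \int[lebesgue_n n]_x f (vscale m x))%E.
Proof.
move=> m0; elim: n f => [|n IH] f mf f0.
  rewrite !ge0_integral_lebesgue_n0//; last first.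
    apply: measurableT_comp => //.
    exact: measurable_vscaler.
  by rewrite expr0 mul1e; congr f; rewrite [RHS]tuple0.
rewrite ge0_integral_lebesgue_nS// ge0_integral_lebesgue_nS//; last first.
  apply: measurableT_comp => //.
  exact: measurable_vscaler.
have mfc : measurable_fun setT (f \o @consv R n).
  by apply: measurableT_comp => //; exact: measurable_consv.
rewrite (@ge0_integral_lebesgue_scale m (fun a =>
  \int[lebesgue_n n]_x f (consv (a, x)))%E m0); last 2 first.
  by apply: (@measurable_fun_fubini_tonelli_F _ _ _ _ R (lebesgue_n n)
    (f \o @consv R n)) => // x; exact: f0.
  by move=> x; exact: integral_ge0.
under eq_integral => a _.
  rewrite IH//; last exact: (measurableT_comp mfc (pair1_measurable _)).
  over.
have mh : measurable_fun setT (fun x : measurableTypeR R * euclid R n =>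
   f (consv (m * x.1, vscale m x.2))).
  apply: (measurableT_comp mfc); apply/measurable_fun_pairP; split => /=.
    apply: measurable_funM => //; exact: measurable_fst.
  exact: (measurableT_comp (@measurable_vscaler n m) measurable_snd).
rewrite ge0_integralZl//; last 3 first.
  by apply: (@measurable_fun_fubini_tonelli_F _ _ _ _ R (lebesgue_n n) _ mh).
  by move=> x _; exact: integral_ge0.
  by rewrite lee_fin exprn_ge0// ltW.
rewrite muleA -EFinM -exprS; congr (_ * _)%E.
apply: eq_integral => a _; apply: eq_integral => x _; congr f.
apply: eq_from_tnth => i; rewrite tnth_mktuple; case: (unliftP ord0 i) => [j|] ->.
  by rewrite !tnthS tnth_mktuple.
by [].
Qed.

End lebesgue_n.

(** * The heat kernel *)

Section gauss.
Context {R : realType}.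
Implicit Types (s t a x y z : R) (n : nat).

(** The one-dimensional heat kernel, which for t > 0 is the centred normal density of variance 2t;
    [gauss] is then a product of such factors. *)
Definition gauss1 t a : R :=
  (Num.sqrt (4 * pi * t))^-1 * expR (- (a ^+ 2 / (4 * t))).

Lemma gauss1_ge0 t a : 0 <= gauss1 t a.
Proof. by rewrite mulr_ge0 ?expR_ge0// invr_ge0 sqrtr_ge0. Qed.

Lemma gauss1_normal_pdf t a z : 0 < t ->
  gauss1 t (a - z) = normal_pdf z (Num.sqrt (2 * t)) a.
Proof.
move=> t0; rewrite normal_pdfE ?gt_eqF ?sqrtr_gt0 ?mulr_gt0//.
rewrite /gauss1 /normal_peak /normal_fun sqr_sqrtr ?mulr_ge0 ?ltW//.
congr ((Num.sqrt _)^-1 * expR _); first by rewrite mulr2n; ring.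
by rewrite mulNr mulr2n; congr (- (_ / _)); ring.
Qed.

Lemma gauss1N t a : gauss1 t (- a) = gauss1 t a.
Proof. by rewrite /gauss1 sqrrN. Qed.

Lemma measurable_gauss1 t : measurable_fun setT (gauss1 t).
Proof.
apply: measurable_funM => //; apply: measurableT_comp => //.
by apply: measurableT_comp => //; apply: measurable_funM.
Qed.

(** Completing the square in [y]: what remains besides the kernel at time s + t is a normal density
    in [y] of variance 2st/(s + t), centred at a weighted mean of [x] and [z]. It has mass 1, so
    integrating out [y] gives the convolution identity. *)
Lemma gauss1M s t x y z : 0 < s -> 0 < t ->
  gauss1 s (x - y) * gauss1 t (y - z) = gauss1 (s + t) (x - z) *
    normal_pdf ((t * x + s * z) / (s + t)) (Num.sqrt (2 * (s * t / (s + t)))) y.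
Proof.
move=> s0 t0; have st0 : 0 < s + t by exact: addr_gt0.
have p0 : (0 : R) < pi by exact: pi_gt0.
have ? : s != 0 by rewrite gt_eqF.
have ? : t != 0 by rewrite gt_eqF.
have ? : s + t != 0 by rewrite gt_eqF.
rewrite -gauss1_normal_pdf; last by rewrite divr_gt0// mulr_gt0.
rewrite /gauss1 mulrACA [RHS]mulrACA; congr (_ * _).
  rewrite -!invfM -!sqrtrM ?mulr_ge0 ?ltW//; congr (Num.sqrt _)^-1.
  by field.
rewrite -!expRD -!opprD; congr (expR (- _)).
field; exact/and3P.
Qed.

Lemma integral_gauss1M s t x z : 0 < s -> 0 < t ->
  (\int[lebesgue_measure]_y (gauss1 s (x - y) * gauss1 t (y - z))%:E =
   (gauss1 (s + t) (x - z))%:E)%E.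
Proof.
move=> s0 t0; under eq_integral => y _ do rewrite gauss1M// EFinM.
rewrite ge0_integralZl//; last 3 first.
  by apply/measurable_EFinP; exact: measurable_normal_pdf.
  by move=> y _; rewrite lee_fin normal_pdf_ge0.
  by rewrite lee_fin gauss1_ge0.
rewrite integral_normal_pdf ?mule1// gt_eqF// sqrtr_gt0.
Qed.

Lemma integral_gauss1 t x : 0 < t ->
  (\int[lebesgue_measure]_y (gauss1 t (x - y))%:E = 1)%E.
Proof.
move=> t0; under eq_integral => y _.
  rewrite -gauss1N opprB gauss1_normal_pdf//; over.
by rewrite integral_normal_pdf// gt_eqF// sqrtr_gt0 mulr_gt0.
Qed.

Lemma gauss_prod n t (x : euclid R n) : 0 < t ->
  gauss t x = \prod_i gauss1 t (tnth x i).
Proof.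
move=> t0; have p0 : (0 : R) < pi by exact: pi_gt0.
rewrite /gauss /enorm sqr_sqrtr; last by apply: sumr_ge0 => i _; exact: sqr_ge0.
rewrite /gauss1 big_split/= prodr_const card_ord; congr (_ * _).
  rewrite exprVn -powR12_sqrt ?mulr_ge0 ?ltW// -powR_mulrn ?powR_ge0//.
  by rewrite powRN -powRrM (mulrC 2^-1).
rewrite mulr_suml -sumrN.
by rewrite expR_sum.
Qed.

Lemma gauss_ge0 n t (x : euclid R n) : 0 <= gauss t x.
Proof. by rewrite mulr_ge0 ?expR_ge0 ?powR_ge0. Qed.

Lemma gauss_gt0 n t (x : euclid R n) : 0 < t -> 0 < gauss t x.
Proof. by move=> t0; rewrite mulr_gt0 ?expR_gt0 ?powR_gt0// !mulr_gt0// pi_gt0. Qed.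

Lemma measurable_gauss n : measurable_fun setT
  (fun p : measurableTypeR R * euclid R n => gauss p.1 p.2).
Proof.
(* Measurability of the inverse is read off from that of real powers; at 0 both expressions take the
   value 0. *)
have mV : measurable_fun setT (@GRing.inv R).
  rewrite (_ : GRing.inv = fun x : R => x * (x ^+ 2) `^ (-1)); last first.
    apply/funext => x; rewrite powR_inv1 ?sqr_ge0//.
    by have [->|x0] := eqVneq x 0; [rewrite invr0 mul0r|field].
  apply: measurable_funM => //.
  apply: (measurableT_comp (measurable_powR _)).
  exact: measurable_funX.
have m4 (c : R) : measurable_fun setT
    (fun p : measurableTypeR R * euclid R n => c * p.1).
  by apply: measurable_funM => //; exact: measurable_fst.
apply: measurable_funM.
  exact: (measurableT_comp (measurable_powR _)).
apply: measurableT_comp => //; apply: measurableT_comp => //.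
apply: measurable_funM.
  apply: measurable_funX.
  exact: (measurableT_comp (@measurable_enorm R n) measurable_snd).
exact: (measurableT_comp mV (m4 4)).
Qed.

Lemma integral_gauss n t (x : euclid R n) : 0 < t ->
  (\int[lebesgue_n n]_y (gauss t (vsub x y))%:E = 1)%E.
Proof.
move=> t0; under eq_integral => y _.
  rewrite gauss_prod//.
  under eq_bigr => i _ do rewrite tnth_mktuple.
  over.
rewrite (@ge0_integral_lebesgue_n_prod R n
  (fun i a => gauss1 t (tnth x i - a)) (fun=> 1)).
- by rewrite big1.
- move=> i; apply: (measurableT_comp (measurable_gauss1 t)).
  exact: measurable_funB.
- by move=> i a; exact: gauss1_ge0.
- by move=> i; exact: integral_gauss1.
Qed.

Lemma integral_gaussM n s t (x z : euclid R n) : 0 < s -> 0 < t ->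
  (\int[lebesgue_n n]_y (gauss s (vsub x y) * gauss t (vsub y z))%:E =
   (gauss (s + t) (vsub x z))%:E)%E.
Proof.
move=> s0 t0; under eq_integral => y _.
  rewrite !gauss_prod// -big_split/=.
  under eq_bigr => i _ do rewrite !tnth_mktuple.
  over.
rewrite (@ge0_integral_lebesgue_n_prod R n
  (fun i a => gauss1 s (tnth x i - a) * gauss1 t (a - tnth z i))
  (fun i => gauss1 (s + t) (tnth x i - tnth z i))).
- rewrite gauss_prod ?addr_gt0//; congr (_%:E).
  by apply: eq_bigr => i _; rewrite tnth_mktuple.
- move=> i; apply: measurable_funM;
    apply: (measurableT_comp (measurable_gauss1 _)); exact: measurable_funB.
- by move=> i a; rewrite mulr_ge0 ?gauss1_ge0.
- by move=> i; exact: integral_gauss1M.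
Qed.

End gauss.

(** * The heat semigroup and the Duhamel integral *)

Section heat.
Context {R : realType} {n : nat}.
Local Notation mu := (@lebesgue_n R n).
Implicit Types (s t : R) (x y z : euclid R n).
Local Open Scope ereal_scope.

Lemma heat_ge0 t (f : euclid R n -> \bar R) x :
  (forall y, 0 <= f y) -> 0 <= heat t f x.
Proof.
by move=> f0; apply: integral_ge0 => y _; rewrite mule_ge0// lee_fin gauss_ge0.
Qed.

Lemma measurable_gauss_vsub d (T : measurableType d) (t : T -> R)
    (x y : T -> euclid R n) : measurable_fun setT t -> measurable_fun setT x ->
  measurable_fun setT y ->
  measurable_fun setT (fun p => (gauss (t p) (vsub (x p) (y p)))%:E).
Proof.
move=> mt mx my; apply/measurable_EFinP.
apply: (@measurableT_comp _ _ _ _ _ _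
  (fun p : measurableTypeR R * euclid R n => gauss p.1 p.2) _
  (fun p => (t p, vsub (x p) (y p)))); first exact: measurable_gauss.
apply/measurable_fun_pairP; split => //=.
apply: (@measurableT_comp _ _ _ _ _ _
  (fun p : euclid R n * euclid R n => vsub p.1 p.2) _ (fun p => (x p, y p))).
  exact: measurable_vsub.
by apply/measurable_fun_pairP; split.
Qed.

Lemma measurable_heat d (T : measurableType d) (t : T -> R)
    (x : T -> euclid R n) (f : T -> euclid R n -> \bar R) :
  measurable_fun setT t -> measurable_fun setT x ->
  measurable_fun setT (fun p : T * euclid R n => f p.1 p.2) ->
  (forall p y, 0 <= f p y) ->
  measurable_fun setT (fun p => heat (t p) (f p) (x p)).
Proof.
move=> mt mx mf f0.
apply: (@measurable_fun_fubini_tonelli_F _ _ _ _ R mu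
  (fun p : T * euclid R n => (gauss (t p.1) (vsub (x p.1) p.2))%:E * f p.1 p.2)).
  apply: emeasurable_funM => //.
  by apply: measurable_gauss_vsub;
    [exact: (measurableT_comp mt)|exact: (measurableT_comp mx)|].
by move=> p; rewrite mule_ge0// lee_fin gauss_ge0.
Qed.

Lemma measurable_heatx t (f : euclid R n -> \bar R) :
  measurable_fun setT f -> (forall y, 0 <= f y) ->
  measurable_fun setT (heat t f).
Proof.
move=> mf f0.
apply: (@measurable_heat _ _ (fun=> t) id (fun=> f)) => //.
exact: (measurableT_comp mf).
Qed.

Lemma heatM s t x z : (0 < s)%R -> (0 < t)%R ->
  heat s (fun y => (gauss t (vsub y z))%:E) x = (gauss (s + t) (vsub x z))%:E.
Proof.
by move=> s0 t0; rewrite -integral_gaussM.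
Qed.

(** Tonelli exchanges the two space integrals; the inner one is then the convolution of two
    Gaussians, computed by [heatM]. *)
Lemma heat_semigroup s t (f : euclid R n -> \bar R) x :
  (0 < s)%R -> (0 < t)%R ->
  measurable_fun setT f -> (forall y, 0 <= f y) ->
  heat s (heat t f) x = heat (s + t) f x.
Proof.
move=> s0 t0 mf f0; rewrite {1}/heat.
have mG u w : measurable_fun setT (fun y => (gauss u (vsub w y))%:E).
  exact: measurable_gauss_vsub.
have mG' u w : measurable_fun setT (fun y => (gauss u (vsub y w))%:E).
  exact: measurable_gauss_vsub.
have mGG : measurable_fun setT (fun p : euclid R n * euclid R n =>
    (gauss t (vsub p.1 p.2))%:E) by exact: measurable_gauss_vsub.
transitivity (\int[mu]_y \int[mu]_z
   ((gauss s (vsub x y))%:E * ((gauss t (vsub y z))%:E * f z))).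
  apply: eq_integral => y _; rewrite ge0_integralZl// ?lee_fin ?gauss_ge0//.
    exact: emeasurable_funM.
  by move=> z _; rewrite mule_ge0// lee_fin gauss_ge0.
rewrite (@fubini_tonelli _ _ _ _ _ mu mu (fun p =>
   (gauss s (vsub x p.1))%:E * ((gauss t (vsub p.1 p.2))%:E * f p.2)))/=; first last.
  by move=> p; rewrite !mule_ge0// lee_fin gauss_ge0.
  apply: emeasurable_funM; first exact: (measurableT_comp (mG s x)).
  by apply: emeasurable_funM => //; exact: (measurableT_comp mf).
apply: eq_integral => z _; rewrite -heatM//.
rewrite /heat -ge0_integralZr//.
- by apply: eq_integral => y _; rewrite muleA.
- exact: emeasurable_funM.
- by move=> y _; rewrite mule_ge0// lee_fin gauss_ge0.
Qed.

Lemma measurable_heat_duhamel t (F : measurableTypeR R -> euclid R n -> \bar R) :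
  measurable_fun setT
    (fun p : measurableTypeR R * euclid R n => F p.1 p.2) ->
  (forall r y, 0 <= F r y) ->
  measurable_fun setT (fun p : euclid R n * measurableTypeR R =>
    heat (t - p.2) (F p.2) p.1).
Proof.
move=> mF F0; apply: measurable_heat => //.
  by apply: measurable_funB => //; exact: measurable_snd.
apply: (@measurableT_comp _ _ _ _ _ _
  (fun p : measurableTypeR R * euclid R n => F p.1 p.2) _
  (fun p : (euclid R n * measurableTypeR R) * euclid R n => (p.1.2, p.2))) => //.
apply: measurable_fun_pair; last exact: measurable_snd.
exact: (measurableT_comp measurable_snd measurable_fst).
Qed.

Lemma measurable_duhamel t (F : measurableTypeR R -> euclid R n -> \bar R) :
  measurable_fun setT
    (fun p : measurableTypeR R * euclid R n => F p.1 p.2) ->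
  (forall r y, 0 <= F r y) ->
  measurable_fun setT (fun y =>
    \int[lebesgue_measure]_(r in `]0%R, t[) heat (t - r) (F r) y).
Proof.
move=> mF F0.
(* An indicator turns the time integral into one over the whole line, so that Tonelli applies to a
   function on the full product space. *)
under eq_fun do rewrite integral_mkcond epatch_indic.
apply: (@measurable_fun_fubini_tonelli_F _ _ _ _ R lebesgue_measure
  (fun p : euclid R n * measurableTypeR R =>
    heat (t - p.2) (F p.2) p.1 * (\1_`]0%R, t[ p.2)%:E)).
  apply: emeasurable_funM.
    exact: measurable_heat_duhamel.
  apply/measurable_EFinP; apply: (measurableT_comp _ measurable_snd).
  exact: measurable_indic.
by move=> p; rewrite mule_ge0 ?heat_ge0// lee_fin.
Qed.

Lemma heat_duhamel s t (F : measurableTypeR R -> euclid R n -> \bar R) x :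
  (0 < s)%R ->
  measurable_fun setT
    (fun p : measurableTypeR R * euclid R n => F p.1 p.2) ->
  (forall r y, 0 <= F r y) ->
  heat s (fun y => \int[lebesgue_measure]_(r in `]0%R, t[) heat (t - r) (F r) y) x
  = \int[lebesgue_measure]_(r in `]0%R, t[) heat (s + t - r) (F r) x.
Proof.
move=> s0 mF F0; rewrite {1}/heat.
have mFr r : measurable_fun setT (F r).
  exact: (measurableT_comp mF (pair1_measurable r)).
have mG u w : measurable_fun setT (fun y => (gauss u (vsub w y))%:E).
  exact: measurable_gauss_vsub.
have mD : measurable_fun setT (fun r : measurableTypeR R => (\1_`]0%R, t[ r)%:E : \bar R).
  by apply/measurable_EFinP; exact: measurable_indic.
have mH := measurable_heat_duhamel t mF F0.
transitivity (\int[mu]_y \int[lebesgue_measure]_r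
   ((gauss s (vsub x y))%:E * (heat (t - r) (F r) y * (\1_`]0%R, t[ r)%:E))).
  apply: eq_integral => y _; rewrite integral_mkcond epatch_indic.
  rewrite ge0_integralZl// ?lee_fin ?gauss_ge0//.
    exact: emeasurable_funM (measurableT_comp mH (pair1_measurable y)) mD.
  by move=> r _; rewrite mule_ge0 ?heat_ge0// lee_fin.
rewrite (@fubini_tonelli _ _ _ _ _ mu lebesgue_measure (fun p =>
   (gauss s (vsub x p.1))%:E * (heat (t - p.2) (F p.2) p.1 *
   (\1_`]0%R, t[ p.2)%:E)))/=; first last.
  by move=> p; rewrite !mule_ge0 ?heat_ge0// lee_fin ?gauss_ge0.
  apply: emeasurable_funM; first exact: (measurableT_comp (mG s x)).
  exact: emeasurable_funM mH (measurableT_comp mD measurable_snd).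
rewrite [RHS]integral_mkcond epatch_indic.
apply: eq_integral => r _; have mHr : measurable_fun setT (heat (t - r) (F r)).
  exact: measurable_heatx.
transitivity (heat s (heat (t - r) (F r)) x * (\1_`]0%R, t[ r)%:E).
  rewrite /heat -ge0_integralZr//.
  - by apply: eq_integral => y _; rewrite muleA.
  - exact: emeasurable_funM.
  - by move=> y _; rewrite mule_ge0// ?heat_ge0// lee_fin gauss_ge0.
(* Outside []0, t[] both sides vanish; inside, t - r > 0 and the semigroup law applies. *)
rewrite /= indicE; case: (boolP (r \in _)) => [|_]; last by rewrite !mule0.
rewrite inE/= in_itv/= => /andP[_ rt].
have tr : (0 < t - r)%R by rewrite subr_gt0.
rewrite !mule1 -addrA; exact: heat_semigroup.
Qed.

(** Evolving the Duhamel formula at time [t] for a further time [s] moves the final time to s + t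
    but keeps the upper limit [t] of the time integral. This identifies the function H of the
    blow-up argument with a heat evolution of the solution. *)
Lemma heat_mild s t (f : euclid R n -> \bar R)
    (F : measurableTypeR R -> euclid R n -> \bar R) x :
  (0 < s)%R -> (0 < t)%R ->
  measurable_fun setT f -> (forall y, 0 <= f y) ->
  measurable_fun setT
    (fun p : measurableTypeR R * euclid R n => F p.1 p.2) ->
  (forall r y, 0 <= F r y) ->
  heat s (fun y => heat t f y +
    \int[lebesgue_measure]_(r in `]0%R, t[) heat (t - r) (F r) y) x
  = heat (s + t) f x +
    \int[lebesgue_measure]_(r in `]0%R, t[) heat (s + t - r) (F r) x.
Proof.
move=> s0 t0 mf f0 mF F0.
transitivity (heat s (heat t f) x + heat s (fun y =>
    \int[lebesgue_measure]_(r in `]0%R, t[) heat (t - r) (F r) y) x); last first.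
  by congr (_ + _); [exact: heat_semigroup|exact: heat_duhamel].
have mG u w : measurable_fun setT (fun y => (gauss u (vsub w y))%:E).
  exact: measurable_gauss_vsub.
have mI := measurable_duhamel t mF F0.
have I0 y : 0 <= \int[lebesgue_measure]_(r in `]0%R, t[) heat (t - r) (F r) y.
  by apply: integral_ge0 => r _; exact: heat_ge0.
rewrite {1}/heat -ge0_integralD//; last 4 first.
- by move=> y _; rewrite mule_ge0 ?heat_ge0// lee_fin gauss_ge0.
- by apply: emeasurable_funM => //; exact: measurable_heatx.
- by move=> y _; rewrite mule_ge0// lee_fin gauss_ge0.
- exact: emeasurable_funM.
by apply: eq_integral => y _; rewrite ge0_muleDr// heat_ge0.
Qed.

End heat.

(** * Blow-up of mild solutions *)

Section blow_up.
Context {R : realType}.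
Implicit Types (a b c s t x y : R).

(* From (1 + z) ^ (-a) <= exp (- a z / (1 + z)) with z = s x ^ a. *)
Lemma powRN_step a s c x y : 0 < a -> 0 <= s -> 0 < x -> x `^ a <= c ->
  x + s * x `^ (1 + a) <= y ->
  y `^ (- a) + a * s / (1 + (1 + a) * (s * c)) <= x `^ (- a).
Proof.
move=> a0 s0 x0 xc xy; set z := s * x `^ a.
have xa0 : 0 < x `^ a by rewrite powR_gt0.
have z0 : 0 <= z by rewrite mulr_ge0 ?powR_ge0.
have z1 : 0 < 1 + z by rewrite ltr_wpDr.
have zc : z <= s * c by rewrite ler_wpM2l.
have sc0 : 0 <= s * c by exact: le_trans zc.
have y0E : x + s * x `^ (1 + a) = x * (1 + z).
  rewrite powRD ?powRr1 ?(ltW x0)//; last by rewrite (gt_eqF x0) implybT.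
  by rewrite /z; ring.
have y0 : 0 < x * (1 + z) by rewrite mulr_gt0.
have yle : y `^ (- a) <= x `^ (- a) * (1 + z) `^ (- a).
  rewrite -powRM ?(ltW z1) ?(ltW x0)// !powRN lef_pV2 ?posrE ?powR_gt0//; last first.
    by rewrite (lt_le_trans y0)// -y0E.
  rewrite y0E in xy.
  by rewrite ge0_ler_powR ?nnegrE ?(ltW a0) ?(ltW y0)// (le_trans (ltW y0)).
pose w := a * (z / (1 + z)).
have w0 : 0 <= w by rewrite mulr_ge0 ?divr_ge0 ?(ltW a0) ?(ltW z1).
(* This is ln(1 + q) <= q at q = 1/(1 + z) - 1, with signs reversed. *)
have lnz : z / (1 + z) <= ln (1 + z).
  have /le_ln1Dx : -1 < (1 + z)^-1 - 1 by rewrite ltrBrDl subrr invr_gt0.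
  rewrite addrC subrK lnV ?posrE// lerNl => h; apply: le_trans h.
  by rewrite le_eqVlt; apply/orP; left; apply/eqP; field; rewrite gt_eqF.
have zw : (1 + z) `^ (- a) <= (1 + w)^-1.
  rewrite powRN lef_pV2 ?posrE ?powR_gt0//; last by rewrite ltr_wpDr.
  rewrite (le_trans (expR_ge1Dx w))// /powR gt_eqF// ler_expR.
  by rewrite ler_wpM2l// ltW.
have xNa0 : 0 < x `^ (- a) by rewrite powR_gt0.
have {}yle : y `^ (- a) <= x `^ (- a) * (1 + w)^-1.
  by apply: le_trans yle _; rewrite ler_wpM2l// ltW.
rewrite -lerBrDr (le_trans yle)// lerBrDl -lerBrDr.
(* The decrement is computed exactly in terms of z; replacing z by its upper bound s c then makes it
   independent of [x]. *)
have -> : x `^ (- a) - x `^ (- a) * (1 + w)^-1 = a * s / (1 + (1 + a) * z).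
  rewrite powRN /w /z; field.
  by rewrite (gt_eqF xa0) !gt_eqF// ?ltr_wpDr// ?mulr_ge0 ?addr_ge0// ltW.
rewrite ler_wpM2l ?mulr_ge0 ?(ltW a0)//.
have a10 : 0 <= 1 + a by rewrite addr_ge0 ?ltW.
rewrite lef_pV2 ?posrE ?ltr_wpDr// ?(mulr_ge0 a10)//.
by rewrite lerD2l ler_wpM2l.
Qed.

(* Euler scheme for the differential inequality H' >= H ^ (1 + a). *)
Lemma blow_up_time a t (H : R -> R) : 0 < a -> 0 < t -> 0 <= H 0 ->
  (forall s s', 0 <= s -> s <= s' -> s' <= t ->
     H s + (s' - s) * H s `^ (1 + a) <= H s') ->
  a * t * H 0 `^ a <= 1.
Proof.
move=> a0 t0; rewrite le_eqVlt => /predU1P[<- _|H0 Hs].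
  by rewrite powR0 ?gt_eqF// mulr0.
have Hnd s s' : 0 <= s -> s <= s' -> s' <= t -> H s <= H s'.
  move=> s0 ss' s't; apply: le_trans (Hs _ _ s0 ss' s't).
  by rewrite lerDl mulr_ge0 ?powR_ge0// subr_ge0.
have Hgt0 s : 0 <= s -> s <= t -> 0 < H s.
  by move=> s0 st; apply: lt_le_trans H0 _; exact: Hnd.
(* By monotonicity [c] bounds H^a on all of [0, t], so the decrement of [powRN_step] is the same for
   all Euler steps. *)
set c := H t `^ a.
(* Each of the n + 1 steps of length t/(n + 1) lowers H^{-a} by at least [e]; telescoping and
   dropping H(t)^{-a} >= 0 gives the bound. *)
have main n : a * t / (1 + (1 + a) * (t / n.+1%:R * c)) <= H 0 `^ (- a).
  set s := t / n.+1%:R.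
  have sn0 : 0 < s by rewrite divr_gt0.
  pose e := a * s / (1 + (1 + a) * (s * c)).
  have step k : (k <= n.+1)%N -> H (k%:R * s) `^ (- a) + k%:R * e <= H 0 `^ (- a).
    elim: k => [|k IH] kn; first by rewrite !mul0r addr0.
    have kt : k.+1%:R * s <= t.
      by rewrite /s mulrCA ler_piMr ?(ltW t0)// ler_pdivrMr// mul1r ler_nat.
    have kk : k%:R * s <= k.+1%:R * s by rewrite ler_wpM2r ?(ltW sn0)// ler_nat.
    have k0 : 0 <= k%:R * s by rewrite mulr_ge0 ?(ltW sn0).
    apply: le_trans (IH (ltnW kn)).
    have -> : k.+1%:R * e = e + k%:R * e by rewrite -natr1; ring.
    rewrite addrA lerD2r.
    apply: powRN_step => //.
    - exact: ltW.
    - by apply: Hgt0 => //; exact: le_trans kt.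
    - rewrite ge0_ler_powR ?nnegrE ?(ltW a0)//.
      + by rewrite ltW// Hgt0//; exact: le_trans kt.
      + by rewrite ltW// Hgt0// ltW.
      + by apply: Hnd => //; exact: le_trans kt.
    - have sE : k.+1%:R * s - k%:R * s = s by rewrite -natr1; ring.
      by have := Hs _ _ k0 kk kt; rewrite sE.
  have := step n.+1 (leqnn _); rewrite /e => /(le_trans _); apply.
  rewrite ler_wpDl ?powR_ge0//.
  have -> : a * t = n.+1%:R * (a * s).
    by rewrite mulrCA [_ * s]mulrC /s divfK ?pnatr_eq0.
  by rewrite -mulrA.
have p0 : 0 < H 0 `^ (- a) by rewrite powR_gt0.
have c0 : 0 <= c by exact: powR_ge0.
have a10 : 0 < 1 + a by rewrite addr_gt0.
suff le : a * t <= H 0 `^ (- a).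
  rewrite -[leRHS](@mulVf _ (H 0 `^ a)) ?gt_eqF ?powR_gt0//.
  by rewrite ler_wpM2r ?powR_ge0// -powRN.
(* As n grows, the bound [main] tends to the desired one: the error is C/(n + 1), at most [e] once n
   + 1 >= C/e. *)
apply/ler_addgt0Pr => e e0.
set C := H 0 `^ (- a) * ((1 + a) * (t * c)).
have C0 : 0 <= C.
  by rewrite mulr_ge0 ?(ltW p0)// mulr_ge0 ?(ltW a10)// mulr_ge0 ?(ltW t0).
have [n Cn] : exists n : nat, C / e <= n.+1%:R.
  by exists (Num.bound (C / e));
    rewrite (le_trans (ltW (archi_boundP _)))// ?divr_ge0 ?(ltW e0)// ler_nat.
have d0 : 0 < 1 + (1 + a) * (t / n.+1%:R * c).
  rewrite ltr_wpDr// mulr_ge0 ?(ltW a10)// mulr_ge0// divr_ge0//.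
  exact: ltW.
have := main n; rewrite ler_pdivrMr// => /le_trans; apply.
rewrite mulrDr mulr1 lerD2l.
have -> : H 0 `^ (- a) * ((1 + a) * (t / n.+1%:R * c)) = C / n.+1%:R.
  by rewrite /C (mulrAC t) !mulrA.
by rewrite ler_pdivrMr// mulrC -ler_pdivrMr.
Qed.

End blow_up.

(** * Young's and Jensen's inequalities for the power nonlinearity *)

Section nonlinearity.
Context {R : realType}.
Local Open Scope ereal_scope.
Implicit Types (a c : R) (v : \bar R).

Lemma nonlinearity_ge0 a v : 0 <= v -> 0 <= nonlinearity a v.
Proof. by move=> v0; rewrite mule_ge0// poweR_ge0. Qed.

Lemma measurable_nonlinearity a : measurable_fun setT (@nonlinearity R a).
Proof.
apply: emeasurable_funM => //.
by apply: (@measurableT_comp _ _ _ _ _ _ (fun v : \bar R => v `^ a) _ abse);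
  [exact: measurable_poweR|exact: abse_measurable].
Qed.

(** The graph of v^{1+a} lies above its tangent at [c]. For finite [v] this is Young's inequality
    with exponents 1 + a and (1 + a)/a; for infinite [v] the right-hand side is infinite. *)
Lemma nonlinearity_young a c v : (0 < a)%R -> (0 <= c)%R -> 0 <= v ->
  ((1 + a) * c `^ a)%:E * v <= nonlinearity a v + (a * c `^ (1 + a))%:E.
Proof.
move=> a0 c0; have a10 : (0 < 1 + a)%R by rewrite addr_gt0.
case: v => [r| |]//; last first.
  by move=> _; rewrite /nonlinearity/= gt_eqF// mulyy addye// leey.
rewrite lee_fin => r0.
rewrite /nonlinearity/= ger0_norm// -EFinM -EFinM -EFinD lee_fin.
have q0 : (0 < (1 + a) / a)%R by rewrite divr_gt0.
have pq : ((1 + a)^-1 + ((1 + a) / a)^-1 = 1)%R.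
  by field; rewrite !gt_eqF.
have := ler_wpM2l (ltW a10) (conjugate_powR r0 (powR_ge0 c a) a10 q0 pq).
rewrite -powRrM (_ : (a * ((1 + a) / a) = 1 + a)%R); last first.
  by field; rewrite gt_eqF.
move=> h.
have -> : (r `^ a * r = r `^ (1 + a))%R.
  rewrite -[in RHS](mulr_powRB1 r0 a10) mulrC.
  by congr (_ * _ `^ _)%R; ring.
rewrite -mulrA (mulrC (c `^ a)%R) (le_trans h)//.
rewrite le_eqVlt; apply/orP; left; apply/eqP.
by field; rewrite !gt_eqF.
Qed.

(* Jensen's inequality for the probability kernel gauss s (x - .). *)
Lemma heat_nonlinearity_ge n a c s (u : euclid R n -> \bar R) x :
  (0 < a)%R -> (0 <= c)%R -> (0 < s)%R ->
  measurable_fun setT u -> (forall y, 0 <= u y) ->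
  c%:E <= heat s u x ->
  (c `^ (1 + a))%:E <= heat s (fun y => nonlinearity a (u y)) x.
Proof.
move=> a0 c0 s0 mu u0 cu; have a10 : (0 < 1 + a)%R by rewrite addr_gt0.
have mG : measurable_fun setT (fun y => (gauss s (vsub x y))%:E).
  exact: measurable_gauss_vsub.
have mnu : measurable_fun setT (fun y => nonlinearity a (u y)).
  exact: (measurableT_comp (measurable_nonlinearity a)).
have G0 y : 0 <= (gauss s (vsub x y))%:E by rewrite lee_fin gauss_ge0.
have nu0 y : 0 <= nonlinearity a (u y) by rewrite nonlinearity_ge0.
have ca0 : (0 <= c `^ a)%R by exact: powR_ge0.
have ac0 : (0 <= a * c `^ (1 + a))%R by rewrite mulr_ge0 ?powR_ge0 ?ltW.
have cE : (c * c `^ a = c `^ (1 + a))%R.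
  by rewrite -(mulr_powRB1 c0 a10); congr (_ * _ `^ _)%R; ring.
(* The tangent inequality at [c] is integrated against the kernel, whose mass 1 preserves the
   constant term. Infinite values of [u] are covered. *)
have : ((1 + a) * c `^ a)%:E * heat s u x <=
    heat s (fun y => nonlinearity a (u y)) x + (a * c `^ (1 + a))%:E.
  rewrite /heat -ge0_integralZl//; last 3 first.
  - exact: emeasurable_funM.
  - by move=> y _; rewrite mule_ge0.
  - by rewrite lee_fin mulr_ge0 ?(ltW a10).
  rewrite -[X in _ <= _ + X]mule1 -(integral_gauss x s0) -ge0_integralZl//.
  rewrite -ge0_integralD//; first last.
  - by apply: emeasurable_funM.
  - by move=> y _; rewrite mule_ge0// lee_fin.
  - exact: emeasurable_funM.
  - by move=> y _; rewrite mule_ge0.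
  apply: ge0_le_integral => //.
  - by move=> y _; rewrite !mule_ge0// lee_fin mulr_ge0 ?(ltW a10).
  - by apply: emeasurable_funM => //; exact: emeasurable_funM.
  - by apply: emeasurable_funD; exact: emeasurable_funM.
  - move=> y _; rewrite muleCA (muleC _%:E (gauss s (vsub x y))%:E).
    by rewrite -ge0_muleDr// ?lee_fin// lee_wpmul2l// nonlinearity_young.
(* With the heat evolution of [u] at least [c], the left-hand side minus the constant is at least (1
   + a) c^{1+a} - a c^{1+a} = c^{1+a}. *)
rewrite -leeBlDr//; apply: le_trans; rewrite leeBrDr//.
apply: (@le_trans _ _ (((1 + a) * c `^ a)%:E * c%:E)); last first.
  by rewrite lee_wpmul2l// lee_fin mulr_ge0 ?(ltW a10).
rewrite -EFinM -EFinD lee_fin -mulrA (mulrC _ c) cE.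
by rewrite mulrDl mul1r.
Qed.

End nonlinearity.

(** * The heat-flow bound on almost every time slice of a mild solution *)

Lemma ae_product_section d1 d2 (T1 : measurableType d1) (T2 : measurableType d2)
    (R : realType) (m1 : {sigma_finite_measure set T1 -> \bar R})
    (m2 : {sigma_finite_measure set T2 -> \bar R}) (P : T1 * T2 -> Prop) :
  {ae (m1 \x m2)%E, forall p, P p} ->
  {ae m1, forall x, {ae m2, forall y, P (x, y)}}.
Proof.
move=> [A [mA A0 PA]].
have m2A0 x : (0 <= (m2 \o xsection A) x)%E by exact: measure_ge0.
(* The null measure of [A] is the integral of the measures of its sections, so almost every section
   is null. *)
have : (\int[m1]_x `|(m2 \o xsection A) x| = 0)%E.
  by rewrite -[RHS]A0; apply: eq_integral => x _; rewrite gee0_abs.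
move=> /ae_eq_integral_abs => /(_ measurableT).
move=> /(_ (measurable_fun_xsection _ mA)).
apply: filterS => x /(_ I) /= Ax0.
exists (xsection A x); split => //; first exact: measurable_xsection.
by move=> y nP; rewrite /xsection/= inE; apply: PA.
Qed.

Section blow_up_bound.
Context {R : realType} {n : nat}.
Local Notation mu := (@lebesgue_n R n).
Local Notation leb := (@lebesgue_measure R).
Local Open Scope ereal_scope.

Lemma mild_blow_up (alpha t : R) (x : euclid R n) (f : euclid R n -> \bar R)
    (v : measurableTypeR R -> euclid R n -> \bar R) :
  (0 < alpha)%R -> (0 < t)%R ->
  measurable_fun setT f -> (forall y, 0 <= f y) ->
  measurable_fun setT
    (fun p : measurableTypeR R * euclid R n => v p.1 p.2) ->
  (forall s y, 0 <= v s y) ->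
  {ae leb, forall s, `]0%R, t[%classic s -> {ae mu, forall y,
    v s y = heat s f y + \int[leb]_(r in `]0%R, s[)
      heat (s - r) (fun z => nonlinearity alpha (v r z)) y}} ->
  heat t f x + \int[leb]_(r in `]0%R, t[)
    heat (t - r) (fun z => nonlinearity alpha (v r z)) x < +oo ->
  (alpha * t)%:E * heat t f x `^ alpha <= 1.
Proof.
move=> a0 t0 mf f0 mv v0 veq fin.
pose F r z := nonlinearity alpha (v r z).
have F0 r z : 0 <= F r z by rewrite nonlinearity_ge0.
have mF : measurable_fun setT
    (fun p : measurableTypeR R * euclid R n => F p.1 p.2).
  exact: (measurableT_comp (measurable_nonlinearity alpha) mv).
pose Phi r := heat (t - r) (F r) x.
have Phi0 r : 0 <= Phi r by exact: heat_ge0.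
have mPhi : measurable_fun setT Phi.
  exact: (measurableT_comp (measurable_heat_duhamel t mF F0) (pair1_measurable x)).
(* [K] is the function H of the blow-up argument: the final time [t] and the point [x] are fixed,
   and the source acts only up to time [s]. *)
pose K s := heat t f x + \int[leb]_(r in `]0%R, s[) Phi r.
have K0 s : 0 <= K s.
  by rewrite adde_ge0 ?heat_ge0// integral_ge0.
have K_nd s s' : (s <= s')%R -> K s <= K s'.
  move=> ss'; apply: leeD2l; apply: ge0_subset_integral => //.
    exact: measurable_funTS.
  by apply: subset_itvl; rewrite bnd_simp.
(* Finiteness at the final time propagates to earlier times by monotonicity. *)
have Kfin s : (s <= t)%R -> K s = (fine (K s))%:E.
  move=> st; rewrite fineK// ge0_fin_numE//.
  by apply: le_lt_trans fin; exact: K_nd.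
have KE0 : K 0%R = heat t f x.
  by rewrite /K set_itvoo0// integral_set0 adde0.
rewrite -KE0 (Kfin _ (ltW t0)) poweR_EFin -EFinM lee_fin.
apply: (@blow_up_time _ _ _ (fine \o K)) => //; first exact: fine_ge0.
move=> s s' s0 ss' s't /=.
rewrite -lee_fin EFinD -!Kfin ?(le_trans ss')//.
have [<-|sneq] := eqVneq s s'; first by rewrite subrr mul0r adde0.
have {sneq}ss : (s < s')%R by rewrite lt_neqAle sneq.
set c := fine (K s).
have c0 : (0 <= c)%R by exact: fine_ge0.
(* For almost every [r], [heat_mild] identifies [K r] with the heat evolution of [v r] over time t -
   r. As [K r] is at least [K s], Jensen's inequality bounds the source from below. *)
have Phic : {ae leb, forall r, `]s, s'[%classic r -> (c `^ (1 + alpha))%:E <= Phi r}.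
  have aeF := ae_filter_ringOfSetsType (@lebesgue_measure R).
  apply: filterS veq => r vr /=; rewrite in_itv/= => /andP[sr rs'].
  have r0 : (0 < r)%R by exact: le_lt_trans sr.
  have rt : (r < t)%R by exact: lt_le_trans s't.
  have tr0 : (0 < t - r)%R by rewrite subr_gt0.
  have {}vr : {ae mu, forall y, v r y = heat r f y +
      \int[leb]_(q in `]0%R, r[) heat (r - q) (F q) y}.
    by apply: vr; rewrite /= in_itv/= r0.
  have mvr : measurable_fun setT (v r).
    exact: (measurableT_comp mv (pair1_measurable r)).
  apply: heat_nonlinearity_ge => //.
  rewrite /c -Kfin; last by rewrite ltW// (lt_trans sr).
  apply: le_trans (K_nd _ _ (ltW sr)) _.
  have <- : heat (t - r) (fun y => heat r f y +
      \int[leb]_(q in `]0%R, r[) heat (r - q) (F q) y) x = K r.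
    by rewrite (heat_mild x tr0 r0 mf f0 mF F0) subrK.
  rewrite le_eqVlt; apply/orP; left; apply/eqP.
  have mG : measurable_fun setT (fun y => (gauss (t - r) (vsub x y))%:E).
    exact: measurable_gauss_vsub.
  apply: ge0_ae_eq_integral => //.
  - apply: emeasurable_funM => //; apply: emeasurable_funD.
      exact: measurable_heatx.
    exact: measurable_duhamel.
  - exact: emeasurable_funM.
  - move=> y _; rewrite mule_ge0 ?lee_fin ?gauss_ge0// adde_ge0 ?heat_ge0//.
    by apply: integral_ge0 => q _; exact: heat_ge0.
  - by move=> y _; rewrite mule_ge0 ?lee_fin ?gauss_ge0.
  - by apply: filterS vr => y -> _.
have -> : ((s' - s) * c `^ (1 + alpha))%:E =
    \int[leb]_(r in `]s, s'[) cst (c `^ (1 + alpha))%:E r.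
  by rewrite integral_cst//= lebesgue_measure_itv/= lte_fin ss -EFinD -EFinM mulrC.
rewrite /K -addeA leeD2l//.
(* []0, s[] and []s, s'[] are disjoint subsets of []0, s'[], and monotonicity absorbs the missing
   point [s]. *)
apply: (@le_trans _ _ (\int[leb]_(r in `]0%R, s[) Phi r +
    \int[leb]_(r in `]s, s'[) Phi r)).
  apply: leeD2l; apply: ae_ge0_le_integral => //.
  - by move=> r _; rewrite lee_fin powR_ge0.
  - exact: measurable_funTS.
rewrite -ge0_integral_setU//; last 2 first.
- exact: measurable_funTS.
- rewrite disj_set2E; apply/eqP/seteqP; split => // r [] /=.
  rewrite !in_itv/= => /andP[_ rs] /andP[sr _].
  by have := lt_trans rs sr; rewrite ltxx.
apply: ge0_subset_integral => //.
- exact: measurableU.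
- exact: measurable_funTS.
- move=> r [] /=; rewrite !in_itv/= => /andP[r1 r2].
    by rewrite r1 (lt_le_trans r2).
  by rewrite r2 (le_lt_trans s0).
Qed.

(** Reduction to [mild_blow_up], which takes data measurable and nonnegative everywhere, whereas [u]
    is controlled only on [Q] and the sign of [u0] only almost everywhere. *)
Lemma mild_solution_heat_le (alpha T : R) (u0 : euclid R n -> R)
    (u : measurableTypeR R * euclid R n -> \bar R) :
  (0 < alpha)%R -> measurable_fun setT u0 ->
  {ae mu, forall x, (0 <= u0 x)%R} -> mild_solution alpha u0 T u ->
  {ae leb, forall t, `]0%R, T[%classic t -> {ae mu, forall x,
    (alpha * t)%:E * heat t (EFin \o u0) x `^ alpha <= 1}}.
Proof.
have aeF := ae_filter_ringOfSetsType (@lebesgue_measure R).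
move=> a0 mu0 u00 [mu_ u_ge0 u_fin u_eq].
set Q := (`]0%R, T[%classic `*` [set: euclid R n]) in mu_ u_ge0 u_fin u_eq *.
have mQ : measurable Q by exact: measurableX.
(* The positive part of [u0] has the same heat evolution and is nonnegative everywhere. *)
pose f (y : euclid R n) := (Num.max 0%R (u0 y))%:E.
have f0 y : 0 <= f y by rewrite lee_fin le_max lexx.
have mf : measurable_fun setT f.
  by apply/measurable_EFinP; exact: measurable_maxr.
have mG (s : R) (y : euclid R n) :
    measurable_fun setT (fun z => (gauss s (vsub y z))%:E).
  exact: measurable_gauss_vsub.
have mEu0 : measurable_fun setT (EFin \o u0) by exact/measurable_EFinP.
have heatE (s : R) (y : euclid R n) : heat s (EFin \o u0) y = heat s f y.
  apply: ae_eq_integral => //.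

  - exact: emeasurable_funM.
  - exact: emeasurable_funM.
  - by apply: filterS u00 => z z0 _; rewrite /f/= max_r.
pose v (s : measurableTypeR R) (y : euclid R n) := (u \_ Q) (s, y).
have mv : measurable_fun setT
    (fun p : measurableTypeR R * euclid R n => v p.1 p.2).
  rewrite (_ : (fun p => _) = u \_ Q); last by apply/funext => -[].
  (* Extension of [u] by zero outside [Q] is what makes it measurable on the whole product. *)
  by apply/measurable_restrict => //; rewrite setTI.
have v0 s y : 0 <= v s y.
  by rewrite /v patchE; case: ifPn => //; rewrite inE => /u_ge0.
have vE s y : (0 < s < T)%R -> v s y = u (s, y).
  by move=> sT; rewrite /v patchE mem_set//; split => //=; rewrite in_itv.
have EE s y : (0 < s < T)%R ->
    \int[leb]_(r in `]0%R, s[) heat (s - r) (fun z => nonlinearity alpha (u (r, z))) y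
  = \int[leb]_(r in `]0%R, s[) heat (s - r) (fun z => nonlinearity alpha (v r z)) y.
  move=> /andP[_ sT]; apply: eq_integral => r; rewrite inE/= in_itv/= => /andP[r0 rs].
  by apply: eq_integral => z _; rewrite vE// r0 (lt_trans rs).
have sec := ae_product_section u_eq.
have sec2 := ae_product_section u_fin.
have veq : {ae leb, forall s, `]0%R, T[%classic s -> {ae mu, forall y,
    v s y = heat s f y + \int[leb]_(r in `]0%R, s[)
      heat (s - r) (fun z => nonlinearity alpha (v r z)) y}}.
  apply: filterS sec => s us sT.
  have sT' : (0 < s < T)%R by move: sT; rewrite /= in_itv.
  by apply: filterS us => y /(_ (conj sT I))/=; rewrite (vE s y sT') (heatE s y) (EE s y sT').
apply: filterS2 sec sec2 => t ut ft tT.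
have tT' : (0 < t < T)%R by move: tT; rewrite /= in_itv.
have /andP[t0 t_T] := tT'.
apply: filterS2 ut ft => x /(_ (conj tT I))/= utx /(_ (conj tT I)) utf.
rewrite heatE; apply: mild_blow_up a0 t0 mf f0 mv v0 _ _.
  apply: filterS veq => s vs; rewrite /= in_itv/= => /andP[s0 st].
  by apply: vs; rewrite /= in_itv/= s0 (lt_trans st).
(* The integral equation equates the Duhamel expression with u(t, x), which is finite for almost
   every such point. *)
rewrite -EE// -heatE -utx -ge0_fin_numE//.
by apply: u_ge0; split.
Qed.

End blow_up_bound.

(** * Scaling *)

Section scaling.
Context {R : realType} {n : nat}.
Local Notation mu := (@lebesgue_n R n).
Implicit Types (m s t : R) (x y : euclid R n).

Lemma enorm_vscale m x : 0 <= m -> enorm (vscale m x) = m * enorm x.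
Proof.
move=> m0; rewrite /enorm.
under eq_bigr => i _ do rewrite tnth_mktuple exprMn.
by rewrite -mulr_sumr sqrtrM ?sqr_ge0// sqrtr_sqr ger0_norm.
Qed.

Lemma vsub_vscale m x y : vsub (vscale m x) (vscale m y) = vscale m (vsub x y).
Proof. by apply: eq_from_tnth => i; rewrite !tnth_mktuple mulrBr. Qed.

(** Parabolic scaling: at time m^2 the prefactor of the kernel yields m^{-n}, cancelled by the
    Jacobian m^n of the dilation. *)
Lemma gauss_vscale m x : 0 < m ->
  m ^+ n * gauss (m ^+ 2) (vscale m x) = gauss 1 x.
Proof.
move=> m0; have p0 : (0 : R) < pi by exact: pi_gt0.
rewrite /gauss enorm_vscale ?(ltW m0)// mulrA; congr (_ * expR (- _)); last first.
  by field; rewrite gt_eqF.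
rewrite mulr1 powRM ?exprn_ge0 ?mulr_ge0 ?(ltW m0) ?(ltW p0)//.
rewrite -[in X in _ * X](powR_mulrn 2 (ltW m0)) -powRrM.
rewrite (_ : 2 * - (n%:R / 2) = - n%:R :> R); last by field.
rewrite (powRN m n%:R) powR_mulrn ?(ltW m0)//.
by rewrite mulrCA mulfV ?mulr1// expf_neq0// gt_eqF.
Qed.

Local Open Scope ereal_scope.

Lemma heat_vscale m (f : euclid R n -> \bar R) x : (0 < m)%R ->
  measurable_fun setT f -> (forall y, 0 <= f y) ->
  heat (m ^+ 2) f (vscale m x) = heat 1 (fun y => f (vscale m y)) x.
Proof.
move=> m0 mf f0; have mG s z :
    measurable_fun setT (fun y : euclid R n => (gauss s (vsub z y))%:E).
  exact: measurable_gauss_vsub.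
have mGf : measurable_fun setT (fun y : euclid R n =>
    (gauss (m ^+ 2) (vsub (vscale m x) y))%:E * f y) by exact: emeasurable_funM.
rewrite /heat (ge0_integral_lebesgue_n_scale m0)//; last first.
  by move=> y; rewrite mule_ge0// lee_fin gauss_ge0.
rewrite -(@ge0_integralZl _ _ _ mu setT measurableT
  (fun y => (gauss (m ^+ 2) (vsub (vscale m x) (vscale m y)))%:E *
    f (vscale m y))); last 3 first.
- exact: (measurableT_comp mGf (@measurable_vscaler R n m)).
- by move=> y _; rewrite mule_ge0// lee_fin gauss_ge0.
- by rewrite lee_fin exprn_ge0 ?(ltW m0).
apply: eq_integral => y _.
by rewrite muleA -EFinM vsub_vscale gauss_vscale.
Qed.

(** The dilation by [m] multiplies measure by m^n, which is nonzero, so the preimage of a null set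
    is null. *)
Lemma ae_vscale m (P : euclid R n -> Prop) : (0 < m)%R ->
  {ae mu, forall x, P x} -> {ae mu, forall x, P (vscale m x)}.
Proof.
move=> m0 [A [mA A0 PA]]; exists (vscale m @^-1` A).
have mpA : measurable (vscale m @^-1` A).
  by rewrite -[X in measurable X]setTI; exact: measurable_vscaler.
split => //; last by move=> x; exact: PA.
have iA (B : set (euclid R n)) : measurable B -> mu B = \int[mu]_x (\1_B x)%:E.
  by move=> mB; rewrite integral_indic// setIT.
have : mu A = (m ^+ n)%:E * mu (vscale m @^-1` A).
  rewrite (iA A)// (iA (vscale m @^-1` A))// (ge0_integral_lebesgue_n_scale m0)//.
  exact/measurable_EFinP.
rewrite A0 => /esym/eqP; rewrite mule_eq0 eqe expf_eq0 (gt_eqF m0) andbF/=.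
by move/eqP.
Qed.

(** The origin is a box with sides of length 0, and in positive dimension the product of the side
    lengths has a zero factor. *)
Lemma ae_enorm_neq0 : (1 <= n)%N -> {ae mu, forall x, enorm x != 0%R}.
Proof.
move=> n1; exists [set x | forall i, [set 0%R] (tnth x i)]; split.
- rewrite (_ : [set x | _] = \bigcap_(i : 'I_n)
     ((fun x : euclid R n => tnth x i) @^-1` [set 0%R])).
    apply: fin_bigcap_measurable; first exact: finite_finset.
    by move=> i _; rewrite -[X in measurable X]setTI; exact: measurable_tnth.
  by apply/seteqP; split=> [x Ax i _|x Ax i]; [exact: Ax|exact: Ax].
- rewrite (@lebesgue_n_box R n (fun=> [set 0%R]))//.
  by rewrite (bigD1 (Ordinal n1))//= lebesgue_measure_set1 mul0e.
- move=> x /= /negP; rewrite negbK sqrtr_eq0 => sx i /=.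
  have s0 : (\sum_(i < n) tnth x i ^+ 2 = 0)%R.
    by apply/eqP; rewrite eq_le sx sumr_ge0// => j _; exact: sqr_ge0.
  have := psumr_eq0P (fun j _ => sqr_ge0 (tnth x j)) s0 => /(_ i isT).
  by move/eqP; rewrite sqrf_eq0 => /eqP.
Qed.

Lemma le_heat t x (f g : euclid R n -> \bar R) :
  measurable_fun setT f -> measurable_fun setT g ->
  (forall y, 0 <= f y) -> (forall y, 0 <= g y) ->
  {ae mu, forall y, f y <= g y} -> heat t f x <= heat t g x.
Proof.
move=> mf mg f0 g0 fg.
have mG : measurable_fun setT (fun y : euclid R n => (gauss t (vsub x y))%:E).
  exact: measurable_gauss_vsub.
apply: ae_ge0_le_integral => //.
- by move=> y _; rewrite mule_ge0// lee_fin gauss_ge0.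
- exact: emeasurable_funM.
- by move=> y _; rewrite mule_ge0// lee_fin gauss_ge0.
- exact: emeasurable_funM.
by apply: filterS fg => y fgy _; rewrite lee_wpmul2l// lee_fin gauss_ge0.
Qed.

Lemma eq_heat t x (f g : euclid R n -> \bar R) :
  measurable_fun setT f -> measurable_fun setT g ->
  {ae mu, forall y, f y = g y} -> heat t f x = heat t g x.
Proof.
move=> mf mg fg.
have mG : measurable_fun setT (fun y : euclid R n => (gauss t (vsub x y))%:E).
  exact: measurable_gauss_vsub.
apply: ae_eq_integral => //.
- exact: emeasurable_funM.
- exact: emeasurable_funM.
- by apply: filterS fg => y -> _.
Qed.

Lemma heatZ t x (c : R) (f : euclid R n -> \bar R) : (0 <= c)%R ->
  measurable_fun setT f -> (forall y, 0 <= f y) ->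
  heat t (fun y => c%:E * f y) x = c%:E * heat t f x.
Proof.
move=> c0 mf f0.
have mG : measurable_fun setT (fun y : euclid R n => (gauss t (vsub x y))%:E).
  exact: measurable_gauss_vsub.
rewrite /heat -ge0_integralZl//.
- by apply: eq_integral => y _; rewrite muleCA.
- exact: emeasurable_funM.
- by move=> y _; rewrite mule_ge0// lee_fin gauss_ge0.
Qed.

Lemma measurable_ball (r : R) : measurable [set y : euclid R n | (enorm y <= r)%R].
Proof.
rewrite (_ : [set y | _] = enorm @^-1` `]-oo, r]); last first.
  by apply/seteqP; split => y /=; rewrite in_itv.
by rewrite -[X in measurable X]setTI; exact: measurable_enorm.
Qed.

(* Truncation to large balls, by monotone convergence. *)
Lemma heat_ball_exceeds t (f : euclid R n -> \bar R) (M : \bar R) :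
  measurable_fun setT f -> (forall y, 0 <= f y) ->
  0 <= M -> M < 'N[mu]_+oo[heat t f] ->
  exists k : nat, ~ {ae mu, forall x,
    heat t (f \_ [set y | (enorm y <= k%:R)%R]) x <= M}.
Proof.
move=> mf f0 M0 Mlt; apply: contrapT => /forallNP H.
(* By contraposition: if every truncation stays below [M] almost everywhere, so does the limit, and
   hence the sup norm. *)
suff : {ae mu, forall x, heat t f x <= M}.
  move=> fM; move: Mlt; rewrite unlock ltNge => /negP; apply.
  case: ifPn => // _; apply/ess_supP; apply: filterS fM => x.
  by rewrite /= gee0_abs// heat_ge0.
have {H} : forall k : nat, {ae mu, forall x,
    heat t (f \_ [set y | (enorm y <= k%:R)%R]) x <= M}.
  by move=> k; apply: contrapT; exact: H.
move/ae_foralln; apply: filterS => x Hx.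
have mG : measurable_fun setT (fun y : euclid R n => (gauss t (vsub x y))%:E).
  exact: measurable_gauss_vsub.
have E k : heat t (f \_ [set y | (enorm y <= k%:R)%R]) x =
    \int[mu]_(y in [set y | (enorm y <= k%:R)%R]) ((gauss t (vsub x y))%:E * f y).
  rewrite [RHS]integral_mkcond; apply: eq_integral => y _.
  by rewrite !patchE; case: ifP => //; rewrite mule0.
have ndB : nondecreasing_seq (fun k : nat => [set y : euclid R n | (enorm y <= k%:R)%R]).
  by move=> j k jk; apply/subsetPset => y /= /le_trans; apply; rewrite ler_nat.
have UB : \bigcup_k [set y : euclid R n | (enorm y <= k%:R)%R] = setT.
  apply/seteqP; split => // y _; exists (Num.bound (enorm y)) => //=.
  by rewrite ltW// archi_boundP// sqrtr_ge0.
have := @ge0_nondecreasing_set_cvg_integral _ _ R _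
  (fun y => (gauss t (vsub x y))%:E * f y) mu ndB (fun k => measurable_ball k%:R).
rewrite UB => /(_ _ _) cv; have {}cv := cv _ _.
rewrite -[heat t f x](cvg_lim _ (cv _ _))//.
- apply: lime_le.
    by apply/cvg_ex; exists (heat t f x); apply: cv => [k|k y _];
      [apply: measurable_funTS; exact: emeasurable_funM
      |rewrite mule_ge0// lee_fin gauss_ge0].
  by near=> k; rewrite -E.
- by move=> k; apply: measurable_funTS; exact: emeasurable_funM.
- by move=> k y _; rewrite mule_ge0// lee_fin gauss_ge0.
Unshelve. all: by end_near. Qed.

End scaling.

(** A nonempty open interval has positive length, so it is not contained in the exceptional null
    set. *)
Lemma ae_lebesgue_itv_exists {R : realType} (P : R -> Prop) (a b : R) : a < b ->
  {ae lebesgue_measure, forall t : measurableTypeR R, P t} ->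
  exists2 t, a < t < b & P t.
Proof.
move=> ab [A [mA A0 PA]]; apply: contrapT => H.
have abA : `]a, b[%classic `<=` A.
  move=> t /=; rewrite in_itv/= => tab; apply: PA => /= Pt; apply: H.
  by exists t.
have : (lebesgue_measure `]a, b[%classic <= lebesgue_measure A)%E.
  by apply: le_measure => //; rewrite inE.
rewrite A0 lebesgue_measure_itv/= lte_fin ab -EFinD lee_fin subr_le0.
by rewrite leNgt ab.
Qed.

(* Taking logarithms turns both sides into multiples of
   ln lambda + (alpha^-1 - gamma / 2) ln t + alpha^-1 ln alpha + ln M. *)
Lemma scaled_time_le {R : realType} (alpha gamma lambda M t : R) :
  0 < alpha -> gamma < 2 / alpha -> 0 < lambda -> 0 < M -> 0 < t ->
  alpha * t * (lambda * Num.sqrt t `^ (- gamma) * M) `^ alpha <= 1 ->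
  lambda `^ (alpha^-1 - gamma / 2)^-1 * t <=
    ((alpha `^ alpha^-1 * M) `^ (alpha^-1 - gamma / 2)^-1)^-1.
Proof.
move=> a0 ga l0 M0 t0.
set delta := alpha^-1 - gamma / 2.
have d0 : 0 < delta.
  by rewrite subr_gt0 ltr_pdivrMr// mulrC; move: ga; rewrite ltr_pdivlMr.
have s0 : 0 < Num.sqrt t by rewrite sqrtr_gt0.
have sg0 : 0 < Num.sqrt t `^ (- gamma) by rewrite powR_gt0.
have q0 : 0 < lambda * Num.sqrt t `^ (- gamma) * M by rewrite !mulr_gt0.
have p0 : 0 < alpha `^ alpha^-1 * M by rewrite mulr_gt0// powR_gt0.
move=> /ln_le0; rewrite !lnM ?posrE ?mulr_gt0 ?powR_gt0//.
rewrite !ln_powR !lnM ?posrE ?mulr_gt0// ln_powR -powR12_sqrt ?(ltW t0)//.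
rewrite ln_powR => H.
(* [X] is [delta] times the difference of the logarithms of the two sides of the conclusion; the
   hypothesis reads alpha X <= 0. *)
set X := ln lambda + delta * ln t + alpha^-1 * ln alpha + ln M.
have X0 : X <= 0.
  rewrite -(pmulr_rle0 _ a0); apply: le_trans H.
  rewrite le_eqVlt; apply/orP; left; apply/eqP; rewrite /X /delta.
  by field; rewrite gt_eqF.
rewrite -ler_ln ?posrE ?invr_gt0 ?mulr_gt0 ?powR_gt0//.
rewrite lnV ?posrE ?powR_gt0// lnM ?posrE ?powR_gt0// !ln_powR.
rewrite lnM ?posrE ?powR_gt0// ln_powR -subr_le0.
have -> : delta^-1 * ln lambda + ln t -
    - (delta^-1 * (alpha^-1 * ln alpha + ln M)) = delta^-1 * X.
  by rewrite /X; field; rewrite !gt_eqF.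
by rewrite pmulr_rle0// invr_gt0.
Qed.

(** * The life span bound for a fixed level [M] *)

Section life_span_bound.
Context {R : realType} {n : nat}.
Local Notation mu := (@lebesgue_n R n).
Local Notation leb := (@lebesgue_measure R).
Variables (alpha gamma epsilon : R) (omega phi : euclid R n -> R).
Hypothesis alpha_gt0 : 0 < alpha.
Hypothesis gamma_lt : gamma < 2 / alpha.
Hypothesis epsilon_gt0 : 0 < epsilon.
Hypothesis momega : measurable_fun setT omega.
Hypothesis omega_homog : homogeneous 0 omega.
Hypothesis omega_ge0 : {ae mu, forall x, 0 <= omega x}.
Hypothesis mphi : measurable_fun setT phi.
Hypothesis phi_ge0 : {ae mu, forall x, 0 <= phi x}.
Hypothesis phi_ge : {ae mu, forall x, enorm x <= epsilon ->
  omega x * enorm x `^ (- gamma) <= phi x}.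

Local Notation ball k := [set y : euclid R n | enorm y <= k].

(* omega |.|^{-gamma}, made nonnegative everywhere: omega is so only almost
   everywhere. *)
Definition hom_pos (y : euclid R n) : \bar R :=
  (Num.max 0 (omega y) * enorm y `^ (- gamma))%:E.

Local Notation beta := ((alpha^-1 - gamma / 2)^-1).

Lemma hom_pos_ge0 y : (0 <= hom_pos y)%E.
Proof. by rewrite lee_fin mulr_ge0 ?powR_ge0// le_max lexx. Qed.

Lemma measurable_hom_pos : measurable_fun setT hom_pos.
Proof.
apply/measurable_EFinP; apply: measurable_funM.
  exact: measurable_maxr.
exact: (measurableT_comp (measurable_powR _) (@measurable_enorm R n)).
Qed.

(** The dilation by [m] sends the ball of radius [k] into the ball of radius [epsilon], where [phi]
    dominates; homogeneity of degree 0 of [omega] then leaves the factor m^{-gamma}. *)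
Lemma heat_scaled_ge (lambda m k : R) (x : euclid R n) :
  0 < m -> 0 <= lambda -> m * k <= epsilon ->
  ((lambda * m `^ (- gamma))%:E * heat 1 (hom_pos \_ (ball k)) x <=
   heat (m ^+ 2) (EFin \o (fun y => (lambda * phi y)%R)) (vscale m x))%E.
Proof.
move=> m0 l0 mk.
have c0 : 0 <= lambda * m `^ (- gamma) by rewrite mulr_ge0 ?powR_ge0.
have mB : measurable (ball k) by exact: measurable_ball.
have mh : measurable_fun setT (hom_pos \_ (ball k)).
  apply/measurable_restrict => //; rewrite setTI.
  exact: measurable_funTS measurable_hom_pos.
have h0 y : (0 <= (hom_pos \_ (ball k)) y)%E.
  by apply: erestrict_ge0 => z _; exact: hom_pos_ge0.
pose g y : \bar R := (lambda * Num.max 0 (phi y))%:E.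
have g0 y : (0 <= g y)%E by rewrite lee_fin mulr_ge0// le_max lexx.
have mg : measurable_fun setT g.
  apply/measurable_EFinP; apply: measurable_funM => //; exact: measurable_maxr.
rewrite (@eq_heat _ _ (m ^+ 2) _ _ g)//; last 2 first.
- by apply/measurable_EFinP; exact: measurable_funM.
- by apply: filterS phi_ge0 => y y0; rewrite /g /= max_r.
rewrite heat_vscale// -heatZ//; apply: le_heat => //.
- exact: emeasurable_funM.
- exact: (measurableT_comp mg (@measurable_vscaler R n m)).
- by move=> y; rewrite mule_ge0.
have := ae_vscale m0 phi_ge; have := omega_homog m0; have := omega_ge0.
apply: filterS3 => y o0 hom le; rewrite patchE; case: ifPn => [|_]; last first.
  by rewrite mule0.
rewrite inE/= => yk; rewrite lee_fin max_r// -mulrA.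
apply: ler_wpM2l => //; rewrite le_max; apply/orP; right.
have yl : enorm (vscale m y) <= epsilon.
  by rewrite enorm_vscale ?(ltW m0)//; apply: le_trans mk; rewrite ler_pM2l.
move: (le yl); rewrite hom powRr0 mul1r enorm_vscale ?(ltW m0)//.
by rewrite powRM ?(ltW m0) ?sqrtr_ge0// mulrCA.
Qed.

Lemma ae_blow_up_scaled (lambda k M T : R)
    (u : measurableTypeR R * euclid R n -> \bar R) :
  0 <= lambda -> 0 <= M ->
  ~ {ae mu, forall x, (heat 1 (hom_pos \_ (ball k)) x <= M%:E)%E} ->
  mild_solution alpha (fun x => lambda * phi x) T u ->
  {ae leb, forall t, 0 < t < T -> Num.sqrt t * k <= epsilon ->
    alpha * t * (lambda * Num.sqrt t `^ (- gamma) * M) `^ alpha <= 1}.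
Proof.
move=> l0 M0 Mk sol; have aeF := ae_filter_ringOfSetsType (@lebesgue_measure R).
have mlphi : measurable_fun setT (fun x => lambda * phi x).
  exact: measurable_funM.
have lphi0 : {ae mu, forall x, 0 <= lambda * phi x}.
  by apply: filterS phi_ge0 => x; exact: mulr_ge0.
apply: filterS (mild_solution_heat_le alpha_gt0 mlphi lphi0 sol).
(* If the inequality failed at [t], the heat-flow bound at the points sqrt(t) x would keep the
   truncated evolution below [M] for almost every [x], contrary to the choice of [M]. *)
move=> t ht /andP[t0 tT] tk; rewrite leNgt; apply/negP => gt1; apply: Mk.
have m0 : 0 < Num.sqrt t by rewrite sqrtr_gt0.
have tT' : `]0%R, T[%classic t by rewrite /= in_itv/= t0.
apply: filterS (ae_vscale m0 (ht tT')) => x.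
rewrite leNgt => hx; rewrite leNgt; apply: contra hx => hM.
apply: (@lt_le_trans _ _
  (alpha * t * (lambda * Num.sqrt t `^ (- gamma) * M) `^ alpha)%:E).
  by rewrite lte_fin.
have c0 : 0 <= lambda * Num.sqrt t `^ (- gamma) by rewrite mulr_ge0 ?powR_ge0.
have hge := heat_scaled_ge x m0 l0 tk.
rewrite sqr_sqrtr ?(ltW t0)// in hge.
have cM : ((lambda * Num.sqrt t `^ (- gamma) * M)%:E <=
    heat t (EFin \o (fun y => (lambda * phi y)%R)) (vscale (Num.sqrt t) x))%E.
  apply: le_trans hge; rewrite EFinM lee_wpmul2l ?lee_fin//.
  exact: ltW.
have cM0 : (0 <= (lambda * Num.sqrt t `^ (- gamma) * M)%:E)%E.
  by rewrite lee_fin mulr_ge0.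
rewrite [leLHS]EFinM lee_wpmul2l//.
  by rewrite lee_fin mulr_ge0 ?(ltW alpha_gt0) ?(ltW t0).
rewrite -poweR_EFin gt0_ler_poweR ?(ltW alpha_gt0)// in_itv/= leey andbT//.
exact: le_trans cM.
Qed.

(** Were [T] larger, some time strictly above the bound would still be below [T] and (epsilon / (k +
    1))^2 and satisfy the scaled inequality, which [scaled_time_le] forbids. The successor of [k]
    keeps the quotient meaningful for k = 0. *)
Lemma existence_time_le (lambda M T : R) (k : nat)
    (u : measurableTypeR R * euclid R n -> \bar R) :
  0 < lambda -> 0 < M ->
  ~ {ae mu, forall x, (heat 1 (hom_pos \_ (ball k%:R)) x <= M%:E)%E} ->
  ((alpha `^ alpha^-1 * M) `^ beta)^-1 / lambda `^ beta <
    (epsilon / k.+1%:R) ^+ 2 ->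
  mild_solution alpha (fun x => lambda * phi x) T u ->
  T <= ((alpha `^ alpha^-1 * M) `^ beta)^-1 / lambda `^ beta.
Proof.
move=> l0 M0 Mk; set K := (X in X < _) => Keta sol; rewrite leNgt; apply/negP => KT.
have K0 : 0 <= K by rewrite mulr_ge0 ?invr_ge0 ?powR_ge0.
have Kmin : K < Num.min T ((epsilon / k.+1%:R) ^+ 2) by rewrite lt_min KT.
have [t /andP[Kt]] := ae_lebesgue_itv_exists Kmin
  (ae_blow_up_scaled (ltW l0) (ltW M0) Mk sol).
rewrite lt_min => /andP[tT teta] ht.
have t0 : 0 < t by exact: le_lt_trans Kt.
have tk : Num.sqrt t * k%:R <= epsilon.
  have : Num.sqrt t <= epsilon / k.+1%:R.
    rewrite -[leRHS]ger0_norm ?divr_ge0 ?(ltW epsilon_gt0)//.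
    by rewrite -sqrtr_sqr ler_wsqrtr// ltW.
  rewrite ler_pdivlMr//; apply: le_trans.
  by rewrite ler_wpM2l ?sqrtr_ge0// ler_nat.
have tK := scaled_time_le alpha_gt0 gamma_lt l0 M0 t0 (ht _ tk).
move: Kt; rewrite ltNge /K ler_pdivlMr ?powR_gt0// mulrC tK//.
by rewrite t0.
Qed.

Lemma Tmax_le (M : R) (k : nat) : 0 < M ->
  ~ {ae mu, forall x, (heat 1 (hom_pos \_ (ball k%:R)) x <= M%:E)%E} ->
  exists Lambda : R, forall lambda, Lambda < lambda -> 0 < lambda /\
  (Tmax alpha (fun x => (lambda * phi x)%R) <=
    (((alpha `^ alpha^-1 * M) `^ beta)^-1 / lambda `^ beta)%:E)%E.
Proof.
move=> M0 Mk; set K := ((alpha `^ alpha^-1 * M) `^ beta)^-1.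
have K0 : 0 <= K by rewrite invr_ge0 powR_ge0.
set eta := (epsilon / k.+1%:R) ^+ 2.
have eta0 : 0 < eta by rewrite exprn_gt0 ?divr_gt0.
have b0 : 0 < beta.
  rewrite invr_gt0 subr_gt0 ltr_pdivrMr// mulrC.
  by move: gamma_lt; rewrite ltr_pdivlMr.
(* Beyond this threshold K / lambda^beta < eta, as [existence_time_le] requires. *)
exists ((K / eta) `^ beta^-1) => lambda Kl.
have l0 : 0 < lambda by apply: le_lt_trans Kl; exact: powR_ge0.
have lK : K / lambda `^ beta < eta.
  rewrite ltr_pdivrMr ?powR_gt0// mulrC -ltr_pdivrMr//.
  have := gt0_ltr_powR b0 _ _ Kl; rewrite !nnegrE powR_ge0 (ltW l0).
  by rewrite -powRrM mulVf ?gt_eqF// powRr1 ?divr_ge0 ?(ltW eta0)//; apply.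
split => //; apply: ge_ereal_sup => _ [->|[T [T0 [u sol]] <-]].
  by rewrite lee_fin divr_ge0 ?powR_ge0.
by rewrite lee_fin; exact: existence_time_le l0 M0 Mk lK sol.
Qed.

End life_span_bound.

(** * Passage to the supremum over [M] and conclusion *)

Lemma le_inv_poweR {R : realType} (c b : R) (L S : \bar R) :
  (0 < c)%R -> (0 < b)%R -> (0 < S)%E ->
  (forall M, (0 < M)%R -> (M%:E < S)%E -> (L <= (((c * M) `^ b)^-1)%:E)%E) ->
  (L <= ((c%:E * S) `^ b)^-1)%E.
Proof.
move=> c0 b0 S0 H; rewrite leNgt; apply/negP => LS.
have inv0 : (0 <= ((c%:E * S) `^ b)^-1)%E.
  have : (0 <= (c%:E * S) `^ b)%E by rewrite poweR_ge0.
  case: inveP => //= r r0; rewrite !lee_fin invr_ge0//.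
have L0 : (0 < L)%E by exact: le_lt_trans LS.
have [M1 M10 M1S] : exists2 M, (0 < M)%R & (M%:E < S)%E.
  move: S0; case: (S) => [s| |]//; last by exists 1%R => //; exact: ltry.
  rewrite lte_fin => s0; exists (s / 2); first by rewrite divr_gt0.
  by rewrite lte_fin ltr_pdivrMr// ltr_pMr// ltr1n.
have Lfin : L \is a fin_num.
  by rewrite ge0_fin_numE ?(ltW L0)// (le_lt_trans (H _ M10 M1S))// ltry.
move: H LS L0; rewrite -(fineK Lfin); set l := fine L => H LS.
rewrite lte_fin => l0.
(* [M0] solves (c M0)^{-b} = l, so the hypothesis puts every positive M < S below [M0]. Hence S <=
   M0, which rules out S = +oo and contradicts [LS]. *)
pose M0 := l^-1 `^ b^-1 / c.
have M00 : 0 < M0 by rewrite divr_gt0// powR_gt0 ?invr_gt0.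
have cM0 : (c * M0) `^ b = l^-1.
  rewrite /M0 mulrC divfK ?gt_eqF// -powRrM mulVf ?gt_eqF// powRr1//.
  by rewrite invr_ge0 ltW.
have HM M : 0 < M -> (M%:E < S)%E -> M <= M0.
  move=> M_gt0 MS; rewrite leNgt; apply/negP => lt.
  have := H _ M_gt0 MS; rewrite lee_fin leNgt => /negP; apply.
  have cM_gt0 : 0 < c * M by rewrite mulr_gt0.
  have cM0_gt0 : 0 < c * M0 by rewrite mulr_gt0.
  rewrite -[ltRHS]invrK -cM0 ltf_pV2 ?posrE ?powR_gt0//.
  by rewrite gt0_ltr_powR ?nnegrE ?ltr_pM2l ?(ltW cM_gt0) ?(ltW cM0_gt0).
have SM0 : (S <= M0%:E)%E.
  rewrite leNgt; apply/negP => lt.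
  have [M lM MS] : exists2 M, M0 < M & (M%:E < S)%E.
    move: lt; case: (S) => [s| |]//; last first.
      by exists (M0 + 1); [rewrite ltrDl|exact: ltry].
    rewrite lte_fin => lt; exists ((M0 + s) / 2).
      by rewrite ltr_pdivlMr// mulr_natr mulr2n ltrD2l.
    by rewrite lte_fin ltr_pdivrMr// mulr_natr mulr2n ltrD2r.
  by have := HM _ (lt_trans M00 lM) MS; rewrite leNgt lM.
move: LS; rewrite ltNge => /negP; apply.
move: S0 SM0; case: (S) => [s| |]//; rewrite lte_fin lee_fin => s0 sM0.
have cs_gt0 : 0 < c * s by rewrite mulr_gt0.
have cM0_gt0 : 0 < c * M0 by rewrite mulr_gt0.
rewrite -EFinM poweR_EFin inver gt_eqF ?powR_gt0// lee_fin.
rewrite -[leLHS]invrK -cM0 lef_pV2 ?posrE ?powR_gt0//.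
by rewrite ge0_ler_powR ?nnegrE ?(ltW b0) ?ler_pM2l ?(ltW cs_gt0) ?(ltW cM0_gt0).
Qed.

Theorem theorem1p7 (R : realType) (N : nat) (alpha gamma : R)
    (omega phi : euclid R N -> R) (epsilon : R)
    (N_ge1 : (1 <= N)%N) (alpha_gt0 : 0 < alpha)
    (gamma_gt0 : 0 < gamma) (gamma_ltN : gamma < N%:R)
    (gamma_lt : gamma < 2 / alpha)
    (omega_bounded : omega \in Lfun (lebesgue_n N) +oo%E)
    (omega_homog : homogeneous 0 omega)
    (omega_ge0 : {ae lebesgue_n N, forall x, 0 <= omega x})
    (omega_neq0 : ~ {ae lebesgue_n N, forall x, omega x = 0})
    (phi_L1loc : L1loc phi)
    (phi_ge0 : {ae lebesgue_n N, forall x, 0 <= phi x})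
    (epsilon_gt0 : 0 < epsilon)
    (phi_ge : {ae lebesgue_n N, forall x, enorm x <= epsilon ->
                omega x * enorm x `^ (- gamma) <= phi x}) :
  let beta := (alpha^-1 - gamma / 2)^-1 in
  let psi := fun x : euclid R N => (omega x * enorm x `^ (- gamma))%:E in
  let life := fun lambda : R => Tmax alpha (fun x => lambda * phi x) in
  (\forall lambda \near +oo, (life lambda < +oo)%E) /\
  (limf_esup (fun lambda : R => (lambda `^ beta)%:E * life lambda) (pinfty_nbhs R)
     <= (((alpha `^ alpha^-1)%:E * 'N[lebesgue_n N]_+oo[heat 1 psi]) `^ beta)^-1)%E.
Proof.
move=> beta psi life.
have momega : measurable_fun setT omega.
  by have := sub_Lfun_mfun omega_bounded; rewrite inE.
(* Local integrability gives measurability on each ball, and countably many balls cover the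
   space. *)
have mphi : measurable_fun setT phi.
  have <- : \bigcup_k [set x : euclid R N | enorm x <= k%:R] = setT.
    apply/seteqP; split => // x _; exists (Num.bound (enorm x)) => //=.
    by rewrite ltW// archi_boundP// sqrtr_ge0.
  apply/measurable_fun_bigcup => k; first exact: measurable_ball.
  by apply/measurable_EFinP; have /integrableP[] := phi_L1loc k%:R.
have mpsi : measurable_fun setT psi.
  apply/measurable_EFinP; apply: measurable_funM => //.
  exact: (measurableT_comp (measurable_powR _) (@measurable_enorm R N)).
have mh := measurable_hom_pos gamma momega.
have h0 := hom_pos_ge0 gamma omega.
have heatE : heat 1 psi = heat 1 (hom_pos gamma omega).
  apply/funext => x; apply: eq_heat => //.
  by apply: filterS omega_ge0 => y y0; rewrite /psi /hom_pos max_r.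
have beta0 : 0 < beta.
  rewrite invr_gt0 subr_gt0 ltr_pdivrMr// mulrC.
  by move: gamma_lt; rewrite ltr_pdivlMr.
have c0 : 0 < alpha `^ alpha^-1 by rewrite powR_gt0.
rewrite heatE; set S := Lnorm _ _ _.
(* If the norm were 0, the heat evolution would vanish at some point; positivity of the Gaussian
   would then force [omega] to vanish almost everywhere. *)
have S0 : (0 < S)%E.
  rewrite lt0e Lnorm_ge0 andbT; apply/negP => /eqP Sz; apply: omega_neq0.
  have mheat : measurable_fun setT (heat 1 (hom_pos gamma omega)).
    exact: measurable_heatx.
  have heat0 := Lnorm_eq0_eq0 mheat (ltry 0) Sz.
  (* If the evolution vanished nowhere, [heat0] would make the empty set conull, and every property
     would hold almost everywhere. *)
  have [[x hx]|nex] := pselect (exists x, heat 1 (hom_pos gamma omega) x = 0%E);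
    last first.
    by apply: filterS heat0 => x /(_ I) hx; exfalso; apply: nex; exists x.
  have mG : measurable_fun setT (fun y : euclid R N =>
      (gauss 1 (vsub x y))%:E * hom_pos gamma omega y)%E.
    by apply: emeasurable_funM => //; exact: measurable_gauss_vsub.
  have G0 y : (0 <= (gauss 1 (vsub x y))%:E * hom_pos gamma omega y)%E.
    by rewrite mule_ge0// lee_fin gauss_ge0.
  have : (\int[lebesgue_n N]_y
      `|(gauss 1 (vsub x y))%:E * hom_pos gamma omega y| = 0)%E.
    by rewrite -[RHS]hx; apply: eq_integral => y _; rewrite gee0_abs.
  move=> /(ae_eq_integral_abs _ measurableT mG) Gh0.
  (* The origin is set aside because there the negative power of the norm takes the default value 0,
     so the product says nothing about [omega]. *)
  have en0 := @ae_enorm_neq0 R N N_ge1.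
  apply: filterS3 Gh0 omega_ge0 en0 => y /(_ I)/= /eqP + o0 e0.
  have e0' : 0 < enorm y by rewrite lt_neqAle eq_sym e0 sqrtr_ge0.
  rewrite mule_eq0 eqe gt_eqF ?gauss_gt0//= /hom_pos max_r// eqe mulf_eq0.
  by rewrite [X in _ || X]gt_eqF ?powR_gt0// orbF => /eqP.
have key M : 0 < M -> (M%:E < S)%E -> exists Lambda : R,
    forall lambda, Lambda < lambda -> 0 < lambda /\
    (life lambda <=
      (((alpha `^ alpha^-1 * M) `^ beta)^-1 / lambda `^ beta)%:E)%E.
  move=> M0 MS; have [|k Mk] := heat_ball_exceeds mh h0 _ MS.
    by rewrite lee_fin ltW.
  exact: (Tmax_le alpha_gt0 gamma_lt epsilon_gt0 momega omega_homog omega_ge0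
    mphi phi_ge0 phi_ge M0 Mk).
split.
  have [M M0 MS] : exists2 M, 0 < M & (M%:E < S)%E.
    move: S0; case: (S) => [s| |]//; last by exists 1 => //; exact: ltry.
    rewrite lte_fin => s0; exists (s / 2); first by rewrite divr_gt0.
    by rewrite lte_fin ltr_pdivrMr// ltr_pMr// ltr1n.
  have [Lambda HL] := key _ M0 MS.
  exists Lambda; split; first exact: num_real.
  by move=> lambda /HL[_ /le_lt_trans]; apply; exact: ltry.
apply: le_inv_poweR => // M M0 MS; have [Lambda HL] := key _ M0 MS.
(* The upper limit is an infimum over neighbourhoods of infinity; the half-line above [Lambda]
   already gives the bound for this [M]. *)
rewrite limf_esupE; apply: ge_ereal_inf.
exists (ereal_sup [set ((lambda `^ beta)%:E * life lambda)%E |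
  lambda in [set lambda | Lambda < lambda]]).
  exists [set lambda | Lambda < lambda] => //.
  by exists Lambda; split => //; exact: num_real.
apply: ge_ereal_sup => _ [lambda /HL[l0 lifel] <-].
have lb0 : 0 < lambda `^ beta by rewrite powR_gt0.
apply: (le_trans (lee_wpmul2l _ lifel)); first by rewrite lee_fin ltW.
by rewrite -EFinM lee_fin mulrC divfK// gt_eqF.
Qed.
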